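(* Let $\{P_i\}_{i=1}^m$ $(P_i\in\mathrm{Sym}(\mathbb{R}^{2l}_s))$ be a Clifford system of signature $(m,r)$ on $\mathbb{R}^{2l}_s$, where $s\le 2l-1$, satisfying $m\equiv 0\pmod 4$, $r\equiv 0\pmod 2$ and $l>m$. Then each connected component of the focal variety $M_+$ is inhomogeneous, i.e. not homogeneous.
   Context: For $0\le s\le n$, $\mathbb{R}^n_s$ denotes $\mathbb{R}^n$ with the pseudo-inner product $\langle u,v\rangle={}^t u\,J_{s,n-s}\,v$, where $J_{i,j}:=(-E_i)\oplus E_j$ ($J_{0,j}=E_j$, $J_{i,0}=-E_i$), and $S^{n-1}_s:=\{x\in\mathbb{R}^n_s\mid\langle x,x\rangle=1\}$ is the pseudo-sphere. $\mathrm{Sym}(\mathbb{R}^n_s)$ is the set of linear endomorphisms $Q$ with $\langle Qu,v\rangle=\langle u,Qv\rangle$ for all $u,v$. For a positive integer $l$, $s\in\{0,\ldots,2l\}$, an integer $m>1$ and $r\in\{0,\ldots,m\}$, a Clifford system of signature $(m,r)$ on $\mathbb{R}^{2l}_s$ is a family $\{P_i\}_{i=1}^m$ with $P_i\in\mathrm{Sym}(\mathbb{R}^{2l}_s)$ and $P_iP_j+P_jP_i=2\eta_{ij}I$ for all $i,j$, where $(\eta_{ij})=J_{r,m-r}$. Define $F(x):=\langle x,x\rangle^2-2\sum_{j=1}^m\eta_{jj}\langle P_jx,x\rangle^2$ on $\mathbb{R}^{2l}_s$ and $f:=F|_{S^{2l-1}_s}$. The focal variety is $M_+:=\{x\in S^{2l-1}_s\mid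 (\mathrm{grad}\,f)(x)=0,\ f(x)=1\}$ (gradient in $S^{2l-1}_s$); equivalently $M_+=\{x\in S^{2l-1}_s\mid\langle P_jx,x\rangle=0\ \text{for all } j\in\{1,\ldots,m\}\}$. If non-empty it is a non-degenerate submanifold of codimension $m$ in $S^{2l-1}_s$. A connected submanifold $L\subset S^{2l-1}_s$ is homogeneous if some Lie subgroup of the isometry group of $S^{2l-1}_s$, which is $O(s,2l-s)=\{A\mid{}^tAJ_{s,2l-s}A=J_{s,2l-s}\}$ acting linearly, acts on $L$ (i.e. preserves $L$) transitively. *)

(* Defs.v *)
From HB Require Import structures.
From mathcomp Require Import all_boot all_order all_algebra.
From mathcomp Require Import all_classical all_reals all_analysis.

Set Implicit Arguments.
Unset Strict Implicit.
Unset Printing Implicit Defensive.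

Import Order.TTheory GRing.Theory Num.Theory.
Import numFieldNormedType.Exports.

Local Open Scope classical_set_scope.
Local Open Scope ring_scope.

Section PseudoEuclidean.
Variables (R : realType) (n s : nat).

(* J_{s, n-s} = (-E_s) (+) E_{n-s}; meaningful for s <= n. *)
Definition sigJ : 'M[R]_n :=
  diag_mx (\row_(i < n) (if (i < s)%N then -1 else 1)).

Definition pdot (u v : 'cV[R]_n) : R := (u^T *m sigJ *m v) 0 0.

Definition pseudo_sphere : set 'cV[R]_n := [set x | pdot x x = 1].

Definition pseudo_orthogonal : set 'M[R]_n :=
  [set A | A^T *m sigJ *m A = sigJ].

Definition pself_adjoint (Q : 'M[R]_n) : Prop :=
  forall u v : 'cV[R]_n, pdot (Q *m u) v = pdot u (Q *m v).

(* g is the gradient at x of the restriction of G to the pseudo-sphere: the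
   tangent space at x is the pdot-orthogonal of x, and the differential of the
   restriction is the restriction of the differential of G to it. As pdot is
   non-degenerate on the tangent space, there is at most one such g. *)
Definition is_sphere_grad (G : 'cV[R]_n -> R) (x g : 'cV[R]_n) : Prop :=
  pdot g x = 0 /\
  forall v : 'cV[R]_n, pdot v x = 0 -> pdot g v = 'D_v G x.

End PseudoEuclidean.

Section Clifford.
Variables (R : realType) (n s m r : nat) (P : 'I_m -> 'M[R]_n).

Definition clifford_system : Prop :=
  (forall i, pself_adjoint s (P i)) /\
  (forall i j, P i *m P j + P j *m P i = (2 * sigJ R m r i j)%:M).

Definition clifford_F (x : 'cV[R]_n) : R :=
  pdot s x x ^+ 2
  - 2 * \sum_(j < m) sigJ R m r j j * pdot s (P j *m x) x ^+ 2.

Definition focal_variety : set 'cV[R]_n :=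
  [set x | [/\ pseudo_sphere s x, is_sphere_grad s clifford_F x 0
             & clifford_F x = 1]].

End Clifford.

Section Smooth.
Variables (R : realType) (V W : normedModType R).

(* For finite-dimensional V and open U, this is f being C^k on U. *)
Fixpoint Ck_on (k : nat) (U : set V) (f : V -> W) : Prop :=
  if k is k'.+1 then
    (forall x, U x -> differentiable f x) /\
    (forall v : V, Ck_on k' U (fun x => 'D_v f x))
  else forall x, U x -> {for x, continuous f}.

Definition smooth_on (U : set V) (f : V -> W) : Prop :=
  forall k, Ck_on k U f.

End Smooth.

Section LieSubgroup.
Variables (R : realType) (n : nat).

Definition is_matrix_subgroup (G H : set 'M[R]_n) : Prop :=
  [/\ H `<=` G, H 1%:M,
      forall A B, H A -> H B -> H (A *m B)
    & forall A, H A -> H (invmx A)].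

(* With phi : U -> 'M_n the inverse of a chart of a subset of 'M_n, this says
   that the preimage by g, within D, of the domain of the chart is open
   relatively to D and that g is smooth there when read in the chart. *)
Definition smooth_in_chart (d : nat) (U : set 'cV[R]_d)
    (phi : 'cV[R]_d -> 'M[R]_n) (V : normedModType R) (D : set V)
    (g : V -> 'M[R]_n) : Prop :=
  forall x : V, D x -> (phi @` U) (g x) ->
    exists (O : set V) (h : V -> 'cV[R]_d),
      [/\ open O, O x, smooth_on O h
        & forall y, O y -> U (h y) /\ phi (h y) = g y].

(* A (second countable) d-dimensional Lie group structure on H for which the
   inclusion in 'M_n is an injective immersion, given by countably many inverse
   charts. The topology of H may be strictly finer than the one induced by 'M_n;
   it is Hausdorff because the inclusion is continuous and injective. Some of
   the U a may be empty. *)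
Record lie_group_atlas (H : set 'M[R]_n) (d : nat)
    (U : nat -> set 'cV[R]_d) (phi : nat -> 'cV[R]_d -> 'M[R]_n) : Prop := {
  atlas_open : forall a, open (U a);
  atlas_smooth : forall a, smooth_on (U a) (phi a);
  atlas_immersion : forall a x (v : 'cV[R]_d),
    U a x -> 'D_v (phi a) x = 0 -> v = 0;
  atlas_inj : forall a x y, U a x -> U a y -> phi a x = phi a y -> x = y;
  atlas_cover : \bigcup_a (phi a @` U a) = H;
  atlas_transition : forall a b,
    smooth_in_chart (U b) (phi b) (U a) (phi a);
  atlas_mul : forall a b c,
    smooth_in_chart (U c) (phi c) (U a `*` U b)
      (fun p : 'cV[R]_d * 'cV[R]_d => phi a p.1 *m phi b p.2);
  atlas_inv : forall a b,
    smooth_in_chart (U b) (phi b) (U a) (fun x => invmx (phi a x))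
}.

(* G is meant to be a closed subgroup of GL_n, so that an immersion in 'M_n with
   values in G is an immersion in G. *)
Definition is_lie_subgroup (G H : set 'M[R]_n) : Prop :=
  is_matrix_subgroup G H /\
  exists (d : nat) (U : nat -> set 'cV[R]_d)
    (phi : nat -> 'cV[R]_d -> 'M[R]_n), lie_group_atlas H U phi.

(* pseudo_orthogonal is the isometry group of the pseudo-sphere. *)
Definition homogeneous (s : nat) (L : set 'cV[R]_n) : Prop :=
  exists H : set 'M[R]_n,
    [/\ is_lie_subgroup (pseudo_orthogonal (n := n) s) H,
        forall A x, H A -> L x -> L (A *m x)
      & forall x y, L x -> L y -> exists2 A, H A & A *m x = y].

End LieSubgroup.

(* Main.v *)
Require Import Defs.
From HB Require Import structures.
From mathcomp Require Import all_boot all_order all_algebra all_fingroup.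
From mathcomp Require Import all_classical all_reals all_analysis.
From mathcomp Require Import ring lra zify complex.

Set Implicit Arguments.
Unset Strict Implicit.
Unset Printing Implicit Defensive.

Import Order.TTheory GRing.Theory Num.Theory.
Import numFieldNormedType.Exports.

Local Open Scope classical_set_scope.
Local Open Scope ring_scope.

(** Let [V] be the product [P 1 ... P m], called [volume P] below, and consider
    the quadratic form [<V z, z>].  Because 4 divides [m] and [r] is even, [V] is
    self-adjoint, its square is the identity and it anticommutes with every
    [P j].  The theorem results from the conflict of two facts about a component
    [L] of the focal variety.

    On the one hand [<V z, z>] is not constant on [L]
    ([volume_form_not_constant]).  If it were, the tangent space of the cone over
    [L] would be contained in an eigenspace of [V]; its dimension is [2 l - m],
    whereas the eigenspaces of [V], exchanged by each [P j], have dimension [l].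

    On the other hand the square of [<V z, z>] is invariant under every linear
    isometry [A] preserving [L] ([isometry_volume]).  Were [L] homogeneous, this
    square would be constant on [L], and by connectedness so would be [<V z, z>].
    The invariance comes from the fact that conjugation by [A] preserves the
    span of the [P j], and therefore multiplies [V] by a determinant, equal to 1 or
    to -1.  For this fact, put [Q j = A^-1 (P j) A]: the forms [<Q j z, z>]
    vanish on [L], and one has to deduce from these quadratic equations of [L]
    that the [Q j] are combinations of the [P j].  The cone over [L] is
    parametrised near any of its points by explicit polynomial curves
    ([cone_curve_exists]), and expanding the equations along them to order three
    ([component_jets]) gives enough information on the [Q j], provided that
    [2 m <= l] ([clifford_rigid]).

    The inequality [2 m <= l] follows from [m < l] by the representation theory
    of Clifford algebras ([clifford_dim_bound]): [2 l] is a multiple of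
    [2 ^ (m / 2)], and of 8 when [m = 4]. *)

(** * The pseudo-inner product *)

Lemma eq_mulmx_col (R : pzRingType) (k n : nat) (A B : 'M[R]_(k, n)) :
  (forall v : 'cV[R]_n, A *m v = B *m v) -> A = B.
Proof.
move=> AB; apply/matrixP => i j.
by have /colP/(_ i) := AB (delta_mx j 0); rewrite -!colE !mxE.
Qed.

Section PseudoInnerProduct.
Variables (R : realType) (n s : nat).
Local Notation J := (sigJ R n s).
Local Notation pd := (@pdot R n s).
Implicit Types (u v w x : 'cV[R]_n) (a : R) (Q : 'M[R]_n).

Lemma sigJE (i j : 'I_n) :
  J i j = (if (i < s)%N then -1 else 1) *+ (i == j).
Proof. by rewrite !mxE. Qed.

Lemma sigJ_diagM (i : 'I_n) : J i i * J i i = 1.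
Proof. by rewrite sigJE eqxx mulr1n; case: ifP => _; ring. Qed.

Lemma sigJ_diag_neq0 (i : 'I_n) : J i i != 0.
Proof. by rewrite sigJE eqxx mulr1n; case: ifP => _; rewrite ?oppr_eq0 oner_eq0. Qed.

Lemma sigJ_neq (i j : 'I_n) : i != j -> J i j = 0.
Proof. by rewrite sigJE => /negPf ->. Qed.

Lemma trmx_sigJ : J^T = J.
Proof. exact: tr_diag_mx. Qed.

Lemma sigJ_mul : J *m J = 1%:M.
Proof.
apply/matrixP => i j; rewrite mul_diag_mx mxE [in RHS]mxE sigJE mxE.
by case: eqP => [_|_]; rewrite ?mulr0 //; case: ifP => _ /=; ring.
Qed.

Lemma pdotDl u v w : pd (u + v) w = pd u w + pd v w.
Proof. by rewrite /pdot linearD /= !mulmxDl mxE. Qed.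

Lemma pdotDr u v w : pd w (u + v) = pd w u + pd w v.
Proof. by rewrite /pdot mulmxDr mxE. Qed.

Lemma pdotZl a u w : pd (a *: u) w = a * pd u w.
Proof. by rewrite /pdot linearZ /= -!scalemxAl mxE. Qed.

Lemma pdotZr a u w : pd w (a *: u) = a * pd w u.
Proof. by rewrite /pdot -scalemxAr mxE. Qed.

Lemma pdotC u v : pd u v = pd v u.
Proof.
have tr00 (A : 'M[R]_1) : A 0 0 = A^T 0 0 by rewrite mxE.
by rewrite /pdot tr00 !trmx_mul trmxK trmx_sigJ mulmxA.
Qed.

Lemma pdotNl u w : pd (- u) w = - pd u w.
Proof. by rewrite -scaleN1r pdotZl mulN1r. Qed.

Lemma pdotNr u w : pd w (- u) = - pd w u.
Proof. by rewrite pdotC pdotNl pdotC. Qed.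

Lemma pdotBl u v w : pd (u - v) w = pd u w - pd v w.
Proof. by rewrite pdotDl pdotNl. Qed.

Lemma pdotBr u v w : pd w (u - v) = pd w u - pd w v.
Proof. by rewrite pdotDr pdotNr. Qed.

Lemma pdot0l w : pd 0 w = 0.
Proof. by rewrite -(scale0r 0) pdotZl mul0r. Qed.

Lemma pdot0r w : pd w 0 = 0.
Proof. by rewrite pdotC pdot0l. Qed.

Lemma pdot_suml (I : Type) (r : seq I) (Pr : pred I) (F : I -> 'cV[R]_n) w :
  pd (\sum_(i <- r | Pr i) F i) w = \sum_(i <- r | Pr i) pd (F i) w.
Proof.
elim/big_rec2: _ => [|i _ z _ <-]; first exact: pdot0l.
by rewrite pdotDl.
Qed.

Lemma pdot_sumr (I : Type) (r : seq I) (Pr : pred I) (F : I -> 'cV[R]_n) w :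
  pd w (\sum_(i <- r | Pr i) F i) = \sum_(i <- r | Pr i) pd w (F i).
Proof. by rewrite pdotC pdot_suml; apply: eq_bigr => i _; rewrite pdotC. Qed.

Lemma pdot_nondegenerate u : (forall v, pd u v = 0) -> u = 0.
Proof.
move=> u0; have uJ : u^T *m J = 0.
  apply/rowP => j; have := u0 (delta_mx j 0).
  by rewrite /pdot -colE !mxE.
by apply: trmx_inj; rewrite -[u^T]mulmx1 -sigJ_mul mulmxA uJ mul0mx trmx0.
Qed.

Lemma pdot_mulmxl Q u v : pd (Q *m u) v = pd u (J *m Q^T *m J *m v).
Proof.
rewrite /pdot trmx_mul -!mulmxA; congr ((_ *m _) 0 0).
by rewrite [in RHS](mulmxA J J) sigJ_mul mul1mx.
Qed.

Lemma pself_adjointP Q : pself_adjoint s Q <-> J *m Q = Q^T *m J.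
Proof.
split=> [saQ|QJ u v].
  suff QT : Q = J *m Q^T *m J by rewrite {1}QT !mulmxA sigJ_mul mul1mx.
  apply: eq_mulmx_col => v; apply/eqP; rewrite -subr_eq0; apply/eqP.
  apply: pdot_nondegenerate => u.
  by rewrite pdotC pdotBr -pdot_mulmxl saQ subrr.
by rewrite pdot_mulmxl -(mulmxA J) -QJ mulmxA sigJ_mul mul1mx.
Qed.

Lemma pself_adjointB Q Q' :
  pself_adjoint s Q -> pself_adjoint s Q' -> pself_adjoint s (Q - Q').
Proof. by move=> sQ sQ' u v; rewrite !mulmxBl pdotBl pdotBr sQ sQ'. Qed.

Lemma pself_adjointZ a Q : pself_adjoint s Q -> pself_adjoint s (a *: Q).
Proof. by move=> sQ u v; rewrite -!scalemxAl pdotZl pdotZr sQ. Qed.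

Lemma pself_adjoint_sum (I : finType) (F : I -> 'M[R]_n) :
  (forall i, pself_adjoint s (F i)) -> pself_adjoint s (\sum_i F i).
Proof.
move=> sF u v; rewrite !mulmx_suml pdot_suml pdot_sumr.
by apply: eq_bigr => i _; rewrite sF.
Qed.

Lemma pdot_polar Q (W : 'cV[R]_n -> Prop) : pself_adjoint s Q ->
  (forall v w, W v -> W w -> W (v + w)) ->
  (forall w, W w -> pd (Q *m w) w = 0) ->
  forall v w, W v -> W w -> pd (Q *m v) w = 0.
Proof.
move=> sQ WD Q0 v w Wv Ww; have := Q0 _ (WD _ _ Wv Ww).
rewrite mulmxDr pdotDl !pdotDr (Q0 v) // (Q0 w) // add0r addr0.
by rewrite (sQ w) (pdotC w) -mulr2n => /eqP; rewrite mulrn_eq0 => /eqP.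
Qed.

Section Orthonormal.
Variables (I : finType) (f : I -> 'cV[R]_n) (e : I -> R).
Hypotheses (fE : forall i j, pd (f i) (f j) = e i *+ (i == j))
           (ee : forall i, e i * e i = 1).

Lemma orthonormal_coef (c : I -> R) j :
  pd (\sum_i c i *: f i) (f j) = c j * e j.
Proof.
rewrite pdot_suml (bigD1 j) //= pdotZl fE eqxx mulr1n big1 ?addr0 // => i ij.
by rewrite pdotZl fE (negPf ij) mulr0n mulr0.
Qed.

Lemma orthonormal_proj w j :
  pd (w - \sum_i (e i * pd w (f i)) *: f i) (f j) = 0.
Proof. by rewrite pdotBl orthonormal_coef mulrC mulrA ee mul1r subrr. Qed.

(** The span of the family is non-degenerate, hence equal to its double
    orthogonal. *)
Lemma orthonormal_expand w :
  (forall v, (forall i, pd v (f i) = 0) -> pd w v = 0) ->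
  w = \sum_i (e i * pd w (f i)) *: f i.
Proof.
move=> w0; set p := \sum_i _; apply/eqP; rewrite -subr_eq0; apply/eqP.
have wp0 j : pd (w - p) (f j) = 0 by exact: orthonormal_proj.
apply: pdot_nondegenerate => u; pose pu := \sum_i (e i * pd u (f i)) *: f i.
have upu j : pd (u - pu) (f j) = 0 by exact: orthonormal_proj.
rewrite -(subrK pu u) pdotDr [pd _ pu]pdotC pdot_suml.
rewrite [X in _ + X]big1 ?addr0; last first.
  by move=> i _; rewrite pdotZl (pdotC (f i)) wp0 mulr0.
rewrite pdotBl w0 // sub0r pdot_suml big1 ?oppr0 // => i _.
by rewrite pdotZl (pdotC (f i)) upu mulr0.
Qed.

(** The orthogonal [W] of the family is non-degenerate, of dimension at least
    [n - #|I|].  If it is totally isotropic for [<B _, _>], then [B W] is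
    orthogonal to [W] and so meets it only in 0.  This bounds [dim W] by half of
    [n]: if [B] is invertible because [B W] has the dimension of [W], and if
    [B ^ 2 = 0] because [B W] and the part of [W] killed by [B] are independent
    subspaces of the kernel of [B], of dimension at most half of [n], whose
    dimensions add up to [dim W]. *)
Lemma isotropic_bound (B : 'M[R]_n) (c : R) :
  (forall v w, (forall i, pd v (f i) = 0) -> (forall i, pd w (f i) = 0) ->
     pd (B *m v) w = 0) ->
  B *m B = c%:M -> (n <= 2 * \rank B)%N -> (n <= 2 * #|I|)%N.
Proof.
move=> Biso BB rB.
pose Z := \matrix_(i < n, k < #|I|) (J *m f (enum_val k)) i 0.
have ZE (u : 'rV_n) k : (u *m Z) 0 k = pd u^T (f (enum_val k)).
  rewrite /pdot trmxK -mulmxA mxE [RHS]mxE.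
  by apply: eq_bigr => i _; rewrite [Z _ _]mxE.
have inW (u : 'rV_n) : (u <= kermx Z)%MS -> forall i, pd u^T (f i) = 0.
  by move=> /sub_kermxP uZ i; rewrite -(enum_rankK i) -ZE uZ mxE.
have rW : (n - #|I| <= \rank (kermx Z))%N.
  by rewrite mxrank_ker leq_sub2l // rank_leq_col.
have cap0 : (kermx Z *m B^T :&: kermx Z)%MS = 0.
  apply/eqP; rewrite -submx0; apply/rV_subP => u; rewrite sub_capmx.
  case/andP=> /submxP [D uE] uW; rewrite submx0; apply/eqP.
  have Dk : (D *m kermx Z <= kermx Z)%MS by apply: submxMl.
  have uT : u^T = B *m (D *m kermx Z)^T by rewrite uE mulmxA trmx_mul trmxK.
  apply: trmx_inj; rewrite trmx0 (@orthonormal_expand u^T) ?big1 //.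
    by move=> i _; rewrite (inW _ uW) mulr0 scale0r.
  by move=> v v0; rewrite uT Biso //; exact: inW.
have BBt : B^T *m B^T = c%:M by rewrite -trmx_mul BB tr_scalar_mx.
suff : (2 * \rank (kermx Z) <= n)%N by lia.
have [c0|c0] := eqVneq c 0; last first.
  have fB : row_free B^T.
    apply/row_freeP; exists (c^-1 *: B^T).
    by rewrite -scalemxAr BBt scale_scalar_mx mulVf.
  have := mxrank_sum_cap (kermx Z *m B^T) (kermx Z).
  rewrite cap0 mxrank0 addn0 (mxrankMfree _ fB).
  by have := rank_leq_col (kermx Z *m B^T + kermx Z)%MS; lia.
rewrite c0 raddf0 in BBt.
set K := (kermx Z :&: kermx B^T)%MS.
have cap1 : (kermx Z *m B^T :&: K)%MS = 0.
  by apply/eqP; rewrite -submx0 -cap0 capmxS // capmxSl.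
have leK : (kermx Z *m B^T + K <= kermx B^T)%MS.
  by rewrite addsmx_sub capmxSr andbT; apply/sub_kermxP; rewrite -mulmxA BBt mulmx0.
have := mxrank_sum_cap (kermx Z *m B^T) K.
rewrite cap1 mxrank0 addn0 mxrank_mul_ker.
by have := mxrankS leK; rewrite mxrank_ker mxrank_tr; lia.
Qed.

End Orthonormal.

End PseudoInnerProduct.

(** * Clifford systems *)

Lemma mulr2n_inj (R : numFieldType) (V : lmodType R) (u v : V) :
  u *+ 2 = v *+ 2 -> u = v.
Proof.
rewrite -[u *+ 2]scaler_nat -[v *+ 2]scaler_nat.
by apply: scalerI; rewrite pnatr_eq0.
Qed.

Section CliffordSystem.
Variables (R : realType) (n s m r : nat) (P : 'I_m -> 'M[R]_n).
Hypothesis hP : clifford_system s r P.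
Local Notation pd := (@pdot R n s).
Local Notation eta j := (sigJ R m r j j).
Implicit Types (u v w x : 'cV[R]_n) (b : 'I_m -> R).

Lemma clifford_adj i : pself_adjoint s (P i).
Proof. by case: hP. Qed.

Lemma clifford_rel i j : P i *m P j + P j *m P i = (2 * sigJ R m r i j)%:M.
Proof. by case: hP => _; apply. Qed.

Lemma clifford_sq i : P i *m P i = (eta i)%:M.
Proof.
have := clifford_rel i i; rewrite -mulr2n mulr_natl raddfMn /=.
exact: mulr2n_inj.
Qed.

Lemma clifford_anti i j : i != j -> P i *m P j = - (P j *m P i).
Proof.
move=> ij; have := clifford_rel i j.
by rewrite sigJ_neq // mulr0 raddf0 => /eqP; rewrite addr_eq0 => /eqP.
Qed.

Lemma clifford_gram x i j :
  pd (P i *m x) (P j *m x) = sigJ R m r i j * pd x x.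
Proof.
have /(congr1 (fun A : 'M[R]_n => pd (A *m x) x)) := clifford_rel i j.
rewrite mulmxDl pdotDl -!mulmxA mul_scalar_mx pdotZl.
rewrite (clifford_adj i (P j *m x)) (clifford_adj j (P i *m x)).
by rewrite (pdotC s (P j *m x)) => h; lra.
Qed.

Definition clifford_comb b : 'M[R]_n := \sum_j b j *: P j.

Lemma clifford_combE b v : clifford_comb b *m v = \sum_j b j *: (P j *m v).
Proof. by rewrite mulmx_suml; apply: eq_bigr => j _; rewrite -scalemxAl. Qed.

Lemma clifford_comb_adj b : pself_adjoint s (clifford_comb b).
Proof.
by apply: pself_adjoint_sum => j; apply: pself_adjointZ; apply: clifford_adj.
Qed.

Lemma clifford_comb_anti b k :
  clifford_comb b *m P k + P k *m clifford_comb b = (2 * (eta k * b k))%:M.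
Proof.
rewrite mulmx_suml mulmx_sumr -big_split /= (bigD1 k) //= big1 ?addr0.
  rewrite -scalemxAl -scalemxAr -scalerDr clifford_rel scale_scalar_mx.
  by congr (_%:M); ring.
move=> i ik; rewrite -scalemxAl -scalemxAr -scalerDr clifford_rel sigJ_neq //.
by rewrite mulr0 raddf0 scaler0.
Qed.

Lemma clifford_comb_sq b :
  clifford_comb b *m clifford_comb b = (\sum_j eta j * b j ^+ 2)%:M.
Proof.
have: clifford_comb b *m clifford_comb b *+ 2 = (\sum_j eta j * b j ^+ 2)%:M *+ 2.
  set C := clifford_comb b.
  have Cr : C *m C = \sum_j b j *: (C *m P j).
    by rewrite {2}/C mulmx_sumr; apply: eq_bigr => j _; rewrite -scalemxAr.
  have Cl : C *m C = \sum_j b j *: (P j *m C).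
    by rewrite {1}/C mulmx_suml; apply: eq_bigr => j _; rewrite -scalemxAl.
  rewrite mulr2n {1}Cr Cl -big_split /= raddf_sum -sumrMnl.
  apply: eq_bigr => j _; rewrite -scalerDr clifford_comb_anti scale_scalar_mx.
  by rewrite -raddfMn /=; congr (_%:M); ring.
exact: mulr2n_inj.
Qed.

(** The vector [b] may be null, and [clifford_comb b] is then nilpotent.  Its
    anticommutator with [P k] is still an invertible scalar, and has at most
    twice its rank. *)
Lemma clifford_comb_rank b k : b k != 0 -> (n <= 2 * \rank (clifford_comb b))%N.
Proof.
move=> bk; have := clifford_comb_anti b k; set B := clifford_comb b => BP.
have ne0 : 2 * (eta k * b k) != 0.
  by rewrite mulf_neq0 ?pnatr_eq0 // mulf_neq0 ?sigJ_diag_neq0.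
have : (n <= \rank (B *m P k + P k *m B)%R)%N.
  by rewrite BP -scalemx1 mxrank_scale_nz // mxrank1.
move=> /leq_trans; apply; apply: leq_trans (mxrank_add _ _) _.
by rewrite mul2n -addnn leq_add // ?mxrankM_maxl ?mxrankM_maxr.
Qed.

(** When [i], [j], [k] are distinct, reversing the product of [P i], [P j] and
    [P k] changes its sign, so that this product is skew-adjoint; otherwise the
    product is a multiple of one of its factors. *)
Lemma clifford_triple x : (forall j, pd (P j *m x) x = 0) ->
  forall i j k, pd (P i *m (P j *m x)) (P k *m x) = 0.
Proof.
move=> q0 i j k; pose t i j k := pd (P i *m (P j *m x)) (P k *m x).
have t23 i' j' k' : t i' j' k' = t i' k' j' by rewrite /t clifford_adj pdotC.
have t12 i' j' k' : t i' j' k' = - t j' i' k'.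
  apply/eqP; rewrite -addr_eq0 /t -pdotDl !mulmxA -mulmxDl clifford_rel.
  by rewrite mul_scalar_mx pdotZl pdotC q0 mulr0.
have : t i j k = - t i j k.
  by rewrite {1}t12 t23 t12 t23 t12 t23 !opprK.
rewrite -/(t i j k) => h; lra.
Qed.

Section FocalPoint.
Variable x : 'cV[R]_n.
Hypotheses (x1 : pd x x = 1) (q0 : forall j, pd (P j *m x) x = 0).

(** The orthogonal of the [P j x], which is the tangent space at [x] of the
    cone over the focal variety. *)
Definition cone_tangent v := forall j, pd v (P j *m x) = 0.

Lemma focal_gram i j : pd (P i *m x) (P j *m x) = eta i *+ (i == j).
Proof.
rewrite clifford_gram x1 mulr1; case: eqP => [->|/eqP ij]; first by rewrite mulr1n.
by rewrite sigJ_neq.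
Qed.

Lemma cone_normal_expand w : (forall v, cone_tangent v -> pd w v = 0) ->
  w = \sum_j (eta j * pd w (P j *m x)) *: (P j *m x).
Proof. exact: (orthonormal_expand focal_gram (@sigJ_diagM _ _ _)). Qed.

Lemma cone_tangent_split w : exists c : 'I_m -> R,
  cone_tangent (w - \sum_j c j *: (P j *m x)).
Proof.
exists (fun j => eta j * pd w (P j *m x)) => j.
exact: (orthonormal_proj focal_gram (@sigJ_diagM _ _ _)).
Qed.

Lemma cone_tangentD v w :
  cone_tangent v -> cone_tangent w -> cone_tangent (v + w).
Proof. by move=> Tv Tw j; rewrite pdotDl Tv Tw addr0. Qed.

Lemma cone_tangentZ a v : cone_tangent v -> cone_tangent (a *: v).
Proof. by move=> Tv j; rewrite pdotZl Tv mulr0. Qed.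

End FocalPoint.
End CliffordSystem.

(** * Rigidity of a Clifford system at a focal point *)

Section Rigidity.
Variables (R : realType) (n s m r : nat) (P Q : 'I_m -> 'M[R]_n).
Hypotheses (hP : clifford_system s r P) (hQ : clifford_system s r Q).
Local Notation pd := (@pdot R n s).
Local Notation eta j := (sigJ R m r j j).
Variable x : 'cV[R]_n.
Hypotheses (x1 : pd x x = 1) (q0 : forall j, pd (P j *m x) x = 0)
  (QP : forall j, Q j *m x = P j *m x).
Local Notation tangent := (cone_tangent s P x).

(** Let [N] be the span of the [P j x], let [T] be its orthogonal and
    [D = Q a - P a].  The first hypothesis says that [D] maps [T] to [N], and
    [clifford_triple] for both systems that it maps [N] to [T].  As [Q a] and
    [P a] have the same square, [P a D + D P a + D ^ 2 = 0], which forces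
    [D N] into [P a N]; being orthogonal to [x], it lies in the span of the
    [P a P c x] with [c != a].  So [D] vanishes on the orthogonal [W] of these
    [m - 1] vectors and of the [m] vectors [P c x].  If [D v] is a non-zero
    combination [clifford_comb b x] for some [v] in [T], the second hypothesis
    at [v + w], for [w] in [W], shows that [W] is totally isotropic for the form
    of [clifford_comb b]; by [isotropic_bound] this needs [n <= 4 m - 2].
    Therefore [D] vanishes on [T], and on [N] by self-adjointness. *)
Lemma clifford_rigid (a : 'I_m) :
  (forall v, tangent v -> pd ((Q a - P a) *m v) v = 0) ->
  (forall v, tangent v ->
     \sum_j eta j * pd (P j *m v) v * pd ((Q a - P a) *m v) (P j *m x) = 0) ->
  (4 * m <= n)%N -> Q a = P a.
Proof.
set D := Q a - P a => D2 D3 mn.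
have sD : pself_adjoint s D.
  by apply: pself_adjointB; [apply: (clifford_adj hQ)|apply: (clifford_adj hP)].
have Dx : D *m x = 0 by rewrite mulmxBl QP subrr.
have TP i j : tangent (P i *m (P j *m x)).
  by move=> k; apply: (clifford_triple hP).
have TD i : tangent (D *m (P i *m x)).
  move=> k; rewrite mulmxBl pdotBl TP subr0 -!QP.
  by apply: (clifford_triple hQ) => j; rewrite QP.
have QE : Q a = P a + D by rewrite addrC subrK.
clearbody D.
have DT v w : tangent v -> tangent w -> pd (D *m v) w = 0.
  apply: (pdot_polar (W := tangent)) => //.
  by move=> *; apply: cone_tangentD.
have DTE v : tangent v ->
    D *m v = \sum_j (eta j * pd (D *m v) (P j *m x)) *: (P j *m x).
  by move=> Tv; apply: (cone_normal_expand hP x1) => w; apply: DT.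
(* [P a D N] lies in [N] *)
have PD i w : tangent w -> pd (P a *m (D *m (P i *m x))) w = 0.
  move=> Tw; have : P a *m D + D *m P a + D *m D = 0.
    have := clifford_sq hQ a; rewrite -(clifford_sq hP a) QE mulmxDl !mulmxDr.
    by move=> h; apply: (addrI (P a *m P a)); rewrite addr0 -[RHS]h !addrA.
  move=> /(congr1 (fun A : 'M[R]_n => pd (A *m (P i *m x)) w)).
  rewrite !mulmxDl mul0mx pdot0l !pdotDl -!mulmxA.
  by rewrite (DT (P a *m (P i *m x))) // (DT (D *m (P i *m x))) // !addr0.
pose I := ('I_m + {c : 'I_m | c != a})%type.
pose f (i : I) : 'cV[R]_n :=
  match i with inl c => P c *m x | inr c => P a *m (P (sval c) *m x) end.
pose e (i : I) : R :=
  match i with inl c => eta c | inr c => eta a * eta (sval c) end.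
have ee i : e i * e i = 1.
  case: i => [c|c] /=; first exact: sigJ_diagM.
  by rewrite mulrACA !sigJ_diagM mulr1.
have fE i j : pd (f i) (f j) = e i *+ (i == j).
  case: i j => [c|c] [d|d] /=.
  - exact: (focal_gram hP).
  - by rewrite pdotC TP.
  - by rewrite TP.
  - rewrite (clifford_adj hP) mulmxA (clifford_sq hP) mul_scalar_mx pdotZr.
    by rewrite (focal_gram hP) // mulrnAr.
(* the coefficient [g a] of [P a P a x], a multiple of [x], is zero *)
have DW w i : (forall j, pd w (f j) = 0) -> pd w (D *m (P i *m x)) = 0.
  move=> w0; have wP c : c != a -> pd w (P a *m (P c *m x)) = 0.
    by move=> ca; apply: (w0 (inr (exist _ c ca))).
  have PDE := cone_normal_expand hP x1 (PD i).
  set g := fun j => eta j * pd (P a *m (D *m (P i *m x))) (P j *m x) in PDE.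
  have PaP v : P a *m (P a *m v) = eta a *: v.
    by rewrite mulmxA (clifford_sq hP) mul_scalar_mx.
  have ga : g a = 0.
    rewrite /g (clifford_adj hP) PaP pdotZr sD Dx pdot0r.
    by rewrite !mulr0.
  have DPE : D *m (P i *m x) = eta a *: (P a *m (\sum_j g j *: (P j *m x))).
    by rewrite -PDE PaP scalerA sigJ_diagM scale1r.
  rewrite DPE pdotZr mulmx_sumr pdot_sumr big1 ?mulr0 // => j _.
  rewrite -scalemxAr pdotZr; have [->|ja] := eqVneq j a; first by rewrite ga mul0r.
  by rewrite wP // mulr0.
have DW0 w : (forall j, pd w (f j) = 0) -> D *m w = 0.
  move=> w0; rewrite DTE; last by move=> j; apply: (w0 (inl j)).
  by rewrite big1 // => j _; rewrite sD DW // mulr0 scale0r.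
have [DT0|] := pselect (forall v j, tangent v -> pd (D *m v) (P j *m x) = 0).
  have DT0' v : tangent v -> D *m v = 0.
    by move=> Tv; rewrite DTE // big1 // => j _; rewrite DT0 // mulr0 scale0r.
  have DPx i : D *m (P i *m x) = 0.
    rewrite [LHS](cone_normal_expand hP x1) ?big1 // => [j _|v Tv].
      by rewrite TD mulr0 scale0r.
    by rewrite sD DT0' // pdot0r.
  suff D0 (v : 'cV[R]_n) : D *m v = 0.
    by rewrite QE; apply: eq_mulmx_col => v; rewrite mulmxDl D0 addr0.
  have [c Tv] := cone_tangent_split hP x1 v.
  rewrite -(subrK (\sum_j c j *: (P j *m x)) v) mulmxDr DT0' // add0r.
  rewrite mulmx_sumr big1 // => j _.
  by rewrite -scalemxAr DPx scaler0.
move=> /existsNP [v] /existsNP [k] /not_implyP [Tv /eqP bk].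
pose b j := eta j * pd (D *m v) (P j *m x).
have b0 : b k != 0 by rewrite mulf_neq0 ?sigJ_diag_neq0.
have b3 w : (forall j, pd w (f j) = 0) -> pd (clifford_comb P b *m w) w = 0.
  move=> w0; have Tw : tangent w by move=> j; apply: (w0 (inl j)).
  have vw (t : R) : \sum_j eta j * pd (P j *m (v + t *: w)) (v + t *: w)
                          * pd (D *m v) (P j *m x) = 0.
    have := D3 _ (cone_tangentD Tv (cone_tangentZ t Tw)).
    by rewrite mulmxDr -scalemxAr (DW0 w) // scaler0 addr0.
  (* a second difference extracts the part that is quadratic in [w] *)
  have : \sum_j (eta j * pd (P j *m (v + 1 *: w)) (v + 1 *: w)
                          * pd (D *m v) (P j *m x)
            + eta j * pd (P j *m (v + -1 *: w)) (v + -1 *: w)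
                          * pd (D *m v) (P j *m x)
            - 2 * (eta j * pd (P j *m v) v * pd (D *m v) (P j *m x))) = 0.
    rewrite sumrB big_split /= -mulr_sumr (vw 1) (vw (-1)) (D3 v Tv).
    by rewrite mulr0 addr0 subr0.
  rewrite clifford_combE pdot_suml => h2.
  suff : 2 * (\sum_j pd (b j *: (P j *m w)) w) = 0 by move=> h3; lra.
  rewrite -[RHS]h2 mulr_sumr; apply: eq_bigr => j _.
  rewrite pdotZl /b !mulmxDr -!scalemxAr !(pdotDl, pdotDr, pdotZl, pdotZr).
  by ring.
have biso v' w' : (forall j, pd v' (f j) = 0) -> (forall j, pd w' (f j) = 0) ->
    pd (clifford_comb P b *m v') w' = 0.
  move=> v0 w0; apply: (pdot_polar (clifford_comb_adj hP b) _ b3) => // y z y0 z0 j.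
  by rewrite pdotDl y0 z0 addr0.
have := isotropic_bound fE ee biso (clifford_comb_sq hP b) (clifford_comb_rank hP b0).
have m0 : (0 < m)%N := leq_ltn_trans (leq0n _) (ltn_ord a).
rewrite card_sum card_ord card_sig.
have -> : #|[pred c | c != a]| = (m - 1)%N.
  by rewrite -[X in (X - 1)%N](card_ord m) cardC1 subn1.
by lia.
Qed.

End Rigidity.

(** * Products of anticommuting elements *)

Section AnticommutingWords.
Variables (A : pzRingType) (T : eqType) (P : T -> A).
Hypothesis anti : forall i j, i != j -> P i * P j = - (P j * P i).

Lemma word_comm k w : k \notin w ->
  P k * \prod_(i <- w) P i
  = (-1) ^+ odd (size w) * (\prod_(i <- w) P i * P k).
Proof.
elim: w => [|i w IHw] /=; first by rewrite !big_nil mulr1 !mul1r.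
rewrite inE negb_or => /andP [ki kw]; rewrite !big_cons mulrA anti //.
rewrite mulNr -!mulrA IHw // !mulr_sign; case: odd => /=.
  by rewrite mulrN opprK.
by [].
Qed.

Lemma word_swap x y w : x != y -> x \notin w -> y \notin w ->
  P y * \prod_(i <- w) P i * P x = - (P x * \prod_(i <- w) P i * P y).
Proof.
move=> xy xw yw; rewrite !word_comm // -!mulrA anti 1?eq_sym //.
by rewrite !mulrN.
Qed.

Lemma word_rev w : uniq w ->
  \prod_(i <- rev w) P i = (-1) ^+ odd 'C(size w, 2) * \prod_(i <- w) P i.
Proof.
elim: w => [|k w IHw] /=; first by rewrite !big_nil mulr1.
case/andP=> kw uw; rewrite rev_cons -cats1 big_cat /= big_seq1 IHw //.
rewrite big_cons word_comm // binS bin1 oddD !mulr_sign.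
by do 2!case: odd => /=; rewrite ?mulNr ?opprK.
Qed.

Lemma word_anti k w : uniq w -> k \in w -> ~~ odd (size w) ->
  P k * \prod_(i <- w) P i = - (\prod_(i <- w) P i * P k).
Proof.
move=> uw /splitPr kw; case: kw uw => w1 w2.
rewrite cat_uniq /= => /and3P [_ /norP [kw1 _] /andP [kw2 _]].
rewrite size_cat /= addnS /= negbK oddD => ow.
rewrite big_cat big_cons /= mulrA (word_comm kw1) -!mulrA.
have := word_comm kw2; rewrite !mulr_sign.
move: ow; case: (odd (size w1)); case: (odd (size w2)) => //= _ h.
  by rewrite -h.
by rewrite -[_ * P k]opprK -h !mulrN opprK.
Qed.

Lemma word_mul_rev (c : T -> A) w : (forall i, P i * P i = c i) ->
  (forall i a, c i * a = a * c i) ->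
  \prod_(i <- w) P i * \prod_(i <- rev w) P i = \prod_(i <- w) c i.
Proof.
move=> PP cC; have wC v a : \prod_(i <- v) c i * a = a * \prod_(i <- v) c i.
  elim: v a => [|k v IHv] a; first by rewrite !big_nil mul1r mulr1.
  by rewrite !big_cons -mulrA IHv mulrA cC mulrA.
elim: w => [|k w IHw]; first by rewrite !big_nil mulr1.
rewrite rev_cons -cats1 big_cat /= big_seq1 !big_cons.
by rewrite -!mulrA (mulrA (\prod_(i <- w) P i)) IHw wC mulrA PP.
Qed.

End AnticommutingWords.

Lemma prod_tperm (A : pzRingType) (T : finType) (P : T -> A) (x y : T) :
  (forall i j, i != j -> P i * P j = - (P j * P i)) -> x != y ->
  \prod_i P (tperm x y i) = - \prod_i P i.
Proof.
move=> anti.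
have key u v w1 w2 w3 : u != v ->
    let w := w1 ++ u :: w2 ++ v :: w3 in uniq w ->
    \prod_(i <- w) P (tperm u v i) = - \prod_(i <- w) P i.
  move=> uv /=; rewrite !(cat_uniq, cons_uniq, mem_cat, in_cons, has_cat) /=.
  rewrite has_cat /= !negb_or => H.
  have uw1 : u \notin w1 by move: H; case: (u \in w1) => //=; rewrite ?andbF.
  have vw1 : v \notin w1 by move: H; case: (v \in w1) => //=; rewrite ?andbF.
  have uw2 : u \notin w2 by move: H; case: (u \in w2) => //=; rewrite ?andbF.
  have vw2 : v \notin w2 by move: H; case: (v \in w2) => //=; rewrite ?andbF.
  have uw3 : u \notin w3 by move: H; case: (u \in w3) => //=; rewrite ?andbF.
  have vw3 : v \notin w3 by move: H; case: (v \in w3) => //=; rewrite ?andbF.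
  have fixw w : u \notin w -> v \notin w ->
      \prod_(i <- w) P (tperm u v i) = \prod_(i <- w) P i.
    move=> uw vw; apply: eq_big_seq => i iw; rewrite tpermD //.
      by apply: contraNneq uw => ->.
    by apply: contraNneq vw => ->.
  rewrite !big_cat /= !big_cons /= !big_cat /= !big_cons /= tpermL tpermR !fixw //.
  transitivity (\prod_(i <- w1) P i * (P v * \prod_(i <- w2) P i * P u)
                * \prod_(i <- w3) P i); first by rewrite !mulrA.
  by rewrite word_swap // mulrN mulNr !mulrA.
move=> xy; have := index_enum_uniq T; have := mem_index_enum x.
have := mem_index_enum y; move: (index_enum T) => w yw xw.
case/splitPr: xw yw => w1 w2; rewrite mem_cat inE eq_sym (negPf xy) /=.
case/orP=> /splitPr [w3 w4].
  by rewrite -catA /= tpermC => /key; apply; rewrite eq_sym.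
exact: key.
Qed.

Lemma prod_perm (A : pzRingType) (T : finType) (P : T -> A) (u : {perm T}) :
  (forall i j, i != j -> P i * P j = - (P j * P i)) ->
  \prod_i P (u i) = (-1) ^+ u * \prod_i P i.
Proof.
move=> anti; case: (prod_tpermP u) => ts -> {u}; elim: ts P anti => [|t ts IHts] P anti.
  move=> _; rewrite big_nil odd_perm1 mul1r.
  by apply: eq_bigr => i _; rewrite perm1.
case/andP=> dt dts; rewrite big_cons; set u := (\prod_(i <- ts) _)%g.
under eq_bigr do rewrite permM.
rewrite (@prod_tperm _ _ (fun i => P (u i))) //; last first.
  by move=> i j ij; rewrite anti // (inj_eq perm_inj).
rewrite IHts // odd_mul_tperm (dt : t.1 != t.2) !mulr_sign -/u.
by case: (odd_perm u) => /=; rewrite ?opprK.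
Qed.

(** By [prod_perm] each product is, up to the factor [m`!], its own
    antisymmetrisation over the orders of the factors.  Expanding the [Q i] there
    turns the coefficient of every word [P (f 0) ... P (f (m - 1))] into a
    determinant, which vanishes unless [f] is a permutation. *)
Lemma prod_anticommuting_det (F : numFieldType) (n m : nat)
    (P Q : 'I_m -> 'M[F]_n) (L : 'M[F]_m) :
  (forall i j, i != j -> P i * P j = - (P j * P i)) ->
  (forall i j, i != j -> Q i * Q j = - (Q j * Q i)) ->
  (forall i, Q i = \sum_j L i j *: P j) ->
  \prod_i Q i = \det L *: \prod_i P i.
Proof.
move=> antiP antiQ QE.
have fact0 : (m`!)%:R != 0 :> F by rewrite pnatr_eq0 -lt0n fact_gt0.
have sumP (X : 'I_m -> 'M[F]_n) (Y : {perm 'I_m} -> 'M[F]_n) :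
    (forall i j, i != j -> X i * X j = - (X j * X i)) ->
    (forall u, Y u = (-1) ^+ u * \prod_i X (u i)) ->
    \sum_u Y u = m`!%:R *: \prod_i X i.
  move=> antiX YE; rewrite scaler_nat -(card_Sn m) -sumr_const.
  apply: eq_big => u; first by rewrite inE.
  by move=> _; rewrite YE prod_perm // mulrA -signr_addb addbb mul1r.
apply: (scalerI fact0); rewrite -(sumP Q _ antiQ (fun u => erefl)).
rewrite scalerA [_ * \det L]mulrC -scalerA -(sumP P _ antiP (fun u => erefl)).
transitivity (\sum_(f : {ffun 'I_m -> 'I_m})
    \det (\matrix_(i, j) L j (f i)) *: \prod_i P (f i)).
  transitivity (\sum_(u : {perm 'I_m}) \sum_(f : {ffun 'I_m -> 'I_m})
     ((-1) ^+ u * \prod_i L (u i) (f i)) *: \prod_i P (f i)).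
    apply: eq_bigr => u _.
    under eq_bigr do rewrite QE.
    rewrite bigA_distr_bigA big_distrr /=; apply: eq_bigr => f _.
    have -> : \prod_i (L (u i) (f i) *: P (f i))
            = (\prod_i L (u i) (f i)) *: \prod_i P (f i).
      elim/big_rec3: _ => [|i X a Y _ ->]; first by rewrite scale1r.
      by rewrite -!mulmxE -scalemxAl -scalemxAr scalerA.
    rewrite -scalerA.
    by rewrite !mulr_sign; case: (odd_perm u); rewrite ?expr0 ?expr1 ?scale1r ?scaleN1r.
  rewrite exchange_big /=; apply: eq_bigr => f _; rewrite -scaler_suml.
  congr (_ *: _); apply: eq_bigr => u _; congr (_ * _).
  by apply: eq_bigr => i _; rewrite mxE.
rewrite (bigID (fun f : {ffun _} => injectiveb f)) /= addrC big1 ?add0r; last first.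
  move=> f /injectivePn [i1 [i2 Di12 Ef12]].
  by rewrite (determinant_alternate Di12) ?scale0r // => j; rewrite !mxE Ef12.
rewrite (reindex (@pval _)) /=; last first.
  pose in_Sn := insubd (1%g : 'S_m).
  by exists in_Sn => /= f Uf; first apply: val_inj; apply: insubdK.
rewrite scaler_sumr; apply: eq_big => /= [u|u _]; first by rewrite (valP u).
have -> : \matrix_(i, j) L j (pval u i) = row_perm u L^T.
  by apply/matrixP => i j; rewrite !mxE pvalE.
rewrite row_permE det_mulmx det_perm det_tr mulrC -scalerA; congr (_ *: _).
rewrite mulr_sign -signr_odd.
by case: (odd_perm u); rewrite ?scaleN1r ?scale1r; under eq_bigr do rewrite pvalE.
Qed.

(** * Dimension of the Clifford modules *)

Section Projectors.
Variables (F : numFieldType) (n : nat).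

(** The rank factorisation of an idempotent consists of a projection onto its
    image and of the inclusion of this image. *)
Lemma idempotent_base (A : 'M[F]_n) : A *m A = A ->
  row_base A *m col_base A = 1%:M.
Proof.
move=> AA; apply: (row_full_inj (col_base_full A)).
apply: (row_free_inj (row_base_free A)).
by rewrite mulmx1 mulmxA mulmx_base -mulmxA -[RHS]AA mulmx_base.
Qed.

Lemma idempotent_trace (A : 'M[F]_n) : A *m A = A -> \tr A = (\rank A)%:R.
Proof.
move=> AA; rewrite -{1}(mulmx_base A) mxtrace_mulC idempotent_base //.
by rewrite mxtrace1.
Qed.

(** The restriction of the form of [G] to the image of [A] is alternating and
    non-degenerate, hence the image has even dimension. *)
Lemma idempotent_rank_even (A G : 'M[F]_n) : A *m A = A ->
  G^T = - G -> G \in unitmx -> G *m A = A^T *m G -> ~~ odd (\rank A).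
Proof.
move=> AA GT Gu GA; set C := col_base A; set B := row_base A.
have BC : B *m C = 1%:M by exact: idempotent_base.
have CB : C *m B = A by exact: mulmx_base.
pose S := C^T *m G *m C; pose S' := B *m invmx G *m B^T.
have SS' : S *m S' = 1%:M.
  have -> : S *m S' = C^T *m (G *m (C *m B)) *m invmx G *m B^T.
    by rewrite /S /S' !mulmxA.
  have AC : A *m C = C by rewrite -[RHS]mulmx1 -BC mulmxA CB.
  by rewrite CB GA mulmxA mulmxK // -!trmx_mul AC BC trmx1.
have dS : \det S != 0.
  apply/eqP => S0; have := congr1 determinant SS'.
  by rewrite det_mulmx S0 mul0r det1 => /eqP; rewrite eq_sym oner_eq0.
have : \det S = (-1) ^+ \rank A * \det S.
  have ST : S^T = - S.
    by rewrite /S trmx_mul (trmx_mul C^T) trmxK GT mulNmx mulmxN mulmxA.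
  by rewrite -[in LHS]det_tr ST -scaleN1r detZ.
rewrite -signr_odd mulr_sign; case: odd => // /eqP.
by rewrite -addr_eq0 -mulr2n mulrn_eq0 (negPf dS).
Qed.

(** Each factor halves the trace, as conjugation by [S i] changes the sign of
    [E i] and fixes the previous ones. *)
Lemma involutions_projector (k : nat) (E S S' : nat -> 'M[F]_n) :
  (forall i, (i < k)%N -> E i *m E i = 1%:M) ->
  (forall i j, (i < k)%N -> (j < i)%N -> E i *m E j = E j *m E i) ->
  (forall i, (i < k)%N -> S i *m S' i = 1%:M) ->
  (forall i, (i < k)%N -> S i *m E i = - (E i *m S i)) ->
  (forall i j, (i < k)%N -> (j < i)%N -> S i *m E j = E j *m S i) ->
  let A := \prod_(i < k) (2^-1 *: (1%:M + E i)) in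
  A *m A = A /\ \tr A * 2 ^+ k = n%:R.
Proof.
elim: k => [|k IHk] EE EC SV SA SC /=.
  by rewrite big_ord0 mulmx1 mxtrace1 mulr1.
have {IHk}[] := IHk (fun i h => EE i (ltnW h)) (fun i j h => EC i j (ltnW h))
  (fun i h => SV i (ltnW h)) (fun i h => SA i (ltnW h)) (fun i j h => SC i j (ltnW h)).
rewrite big_ord_recr /=; set A := \prod_(i < k) _ => AA trA.
have commA X : (forall j, (j < k)%N -> X *m E j = E j *m X) -> X *m A = A *m X.
  move=> XC; rewrite /A; elim/big_ind: _ => [|Y Z XY XZ|i _].
  - by rewrite mulmx1 mul1mx.
  - by rewrite -mulmxE mulmxA XY -!mulmxA XZ.
  - by rewrite -scalemxAr -scalemxAl mulmxDr mulmxDl XC // mulmx1 mul1mx.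
have AE := commA _ (fun j => EC k j (ltnSn k)).
have AS := commA _ (fun j => SC k j (ltnSn k)).
have trAE : \tr (A *m E k) = 0.
  have : \tr (A *m E k) = - \tr (A *m E k).
    rewrite -{1}[A]mulmx1 -(SV k) // mulmxA -AS -!mulmxA mxtrace_mulC.
    have -> : A *m (S' k *m E k) *m S k = A *m (S' k *m E k *m S k) by rewrite -!mulmxA.
    have -> : S' k *m E k *m S k = - E k.
      rewrite -mulmxA -[E k *m S k]opprK -SA // mulmxN mulmxA.
      by rewrite (mulmx1C (SV k _)) // mul1mx.
    by rewrite mulmxN raddfN.
  by move/eqP; rewrite -addr_eq0 -mulr2n mulrn_eq0 => /eqP.
rewrite -mulmxE; split.
  have EkA : (1%:M + E k) *m A = A *m (1%:M + E k).
    by rewrite mulmxDl mulmxDr AE mulmx1 mul1mx.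
  rewrite -!scalemxAr -!scalemxAl !scalerA.
  set X := 1%:M + E k in EkA *; have -> : A *m X *m (A *m X) = A *m (X *m X).
    by rewrite -mulmxA (mulmxA X A) EkA -(mulmxA A X) mulmxA AA.
  rewrite /X.
  have -> : (1%:M + E k) *m (1%:M + E k) = (1%:M + E k) *+ 2.
    by rewrite mulmxDl mul1mx mulmxDr EE // mulmx1 [E k + _]addrC -mulr2n.
  rewrite -[(1%:M + E k) *+ 2]scaler_nat -scalemxAr scalerA; congr (_ *: _).
  by field.
rewrite -scalemxAr linearZ /= mulmxDr mulmx1 linearD /= trAE addr0 -trA exprS.
by field.
Qed.

End Projectors.

(** Over an algebraically closed field the products [p (2 i) * p (2 i + 1)] can be
    rescaled to commuting involutions [E i], to which [involutions_projector]
    applies with [S i = p (2 i)]. *)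
Section ComplexClifford.
Variables (F : numClosedFieldType) (n m : nat) (p : nat -> 'M[F]_n) (e : nat -> F).
Hypotheses (pp : forall i, p i *m p i = (e i)%:M)
  (ee : forall i, e i * e i = 1)
  (p_anti : forall i j, (i < m)%N -> (j < m)%N -> i != j ->
     p i *m p j = - (p j *m p i)).

Let c (i : nat) : F := sqrtC (- (e i.*2 * e i.*2.+1)).
Let E i := c i *: (p i.*2 *m p i.*2.+1).

Let p_comm X i : (i.*2.+1 < m)%N ->
  X *m p i.*2 = - (p i.*2 *m X) -> X *m p i.*2.+1 = - (p i.*2.+1 *m X) ->
  X *m E i = E i *m X.
Proof.
move=> im X1 X2; rewrite -scalemxAr -scalemxAl mulmxA X1 mulNmx -(mulmxA _ X) X2.
by rewrite mulmxN opprK mulmxA.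
Qed.

Let pE_comm i j : (i < m)%N -> (j.*2.+1 < m)%N -> (j < i./2)%N ->
  p i *m E j = E j *m p i.
Proof. by move=> hi hj ji; apply: p_comm => //; apply: p_anti; lia. Qed.

Let pE_anti i : (i.*2.+1 < m)%N -> p i.*2 *m E i = - (E i *m p i.*2).
Proof.
move=> im; rewrite -scalemxAr -scalemxAl -scalerN; congr (_ *: _).
by rewrite -(mulmxA _ _ (p i.*2)) -mulmxN -p_anti //; lia.
Qed.

Let E_sq i : (i.*2.+1 < m)%N -> E i *m E i = 1%:M.
Proof.
move=> im; rewrite /E -scalemxAl -scalemxAr scalerA mulmxA -(mulmxA (p i.*2)).
rewrite p_anti; try lia.
rewrite mulmxN mulNmx mulmxA pp -mulmxA pp -scalar_mxM -scaleN1r scalerA.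
rewrite mulrN1 -expr2 sqrtCK opprK scale_scalar_mx; congr (_%:M).
by rewrite mulrACA !ee mulr1.
Qed.

Let E_comm i j : (i.*2.+1 < m)%N -> (j < i)%N -> E i *m E j = E j *m E i.
Proof.
move=> im ji.
have h : p i.*2 *m p i.*2.+1 *m E j = E j *m (p i.*2 *m p i.*2.+1).
  by rewrite -mulmxA pE_comm ?[in LHS]mulmxA ?pE_comm -?mulmxA //; lia.
by rewrite -[LHS]scalemxAl h scalemxAr.
Qed.

Let A k : 'M[F]_n := \prod_(i < k) (2^-1 *: (1%:M + E i)).

Let A_projector k : (k.*2 <= m)%N -> A k *m A k = A k /\ \tr (A k) * 2 ^+ k = n%:R.
Proof.
move=> km.
apply: (involutions_projector (S := fun i => p i.*2)
          (S' := fun i => e i.*2 *: p i.*2)) => i.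
- by move=> ik; apply: E_sq; lia.
- by move=> j ik ji; apply: E_comm; lia.
- by move=> ik; rewrite -scalemxAr pp scale_scalar_mx ee.
- by move=> ik; apply: pE_anti; lia.
- by move=> j ik ji; apply: pE_comm; lia.
Qed.

Let A_rank k : (k.*2 <= m)%N -> n = (\rank (A k) * 2 ^ k)%N.
Proof.
move=> /A_projector [AA trA]; apply/eqP; rewrite -(eqr_nat F) natrM natrX.
by rewrite -trA idempotent_trace.
Qed.

Lemma anticommuting_dvdn_dim k : (k.*2 <= m)%N -> (2 ^ k %| n)%N.
Proof. by move=> km; apply/dvdnP; exists (\rank (A k)); apply: A_rank. Qed.

(** Divisibility by 4 gains a factor 2 from the form [J]: the product of [J] with
    [p 0 *m p 2] is skew-symmetric and compatible with the projector [A 2], of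
    rank [n / 4], which is therefore even. *)
Lemma anticommuting4_dvdn_dim (J : 'M[F]_n) : (3 < m)%N ->
  J *m J = 1%:M -> J^T = J ->
  (forall i, (i < m)%N -> (p i)^T *m J = J *m p i) -> (8 %| n)%N.
Proof.
move=> m4 JJ JT pJ; have [AA _] := @A_projector 2 m4.
pose Y := p 0 *m p 2; pose G := J *m Y.
have GT : G^T = - G.
  rewrite /G /Y !trmx_mul JT -mulmxA pJ ?(ltn_trans _ m4) //.
  by rewrite (mulmxA _ J) pJ ?(ltn_trans _ m4) // -mulmxA p_anti ?mulmxN //; lia.
have Gu : G \in unitmx.
  have pu i : p i \in unitmx.
    have : p i *m (e i *: p i) = 1%:M by rewrite -scalemxAr pp scale_scalar_mx ee.
    by case/mulmx1_unit.
  by rewrite !unitmx_mul !pu !andbT; apply: (proj1 (mulmx1_unit JJ)).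
have YE i : (i < 2)%N -> p i.*2.+1 *m p i.*2 *m Y = Y *m (p i.*2 *m p i.*2.+1).
  rewrite /Y; case: i => [|[|//]] _ /=.
    rewrite -![0.*2]/0%N !mulmxA -(mulmxA (p 1)) pp mul_mx_scalar -(mulmxA (p 0) (p 2)).
    rewrite (p_anti (i := 2) (j := 0)); try lia.
    rewrite mulmxN mulNmx mulmxA pp mul_scalar_mx -scalemxAl -scalerN.
    by rewrite -p_anti ?scalemxAl //; lia.
  rewrite -![1.*2]/2%N -(mulmxA (p 0)) (mulmxA (p 2) (p 2)) pp mul_scalar_mx -scalemxAr.
  rewrite mulmxA -(mulmxA (p 3)) (p_anti (i := 2) (j := 0)); try lia.
  rewrite mulmxN mulNmx mulmxA -mulmxA pp mul_mx_scalar -scalerN.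
  by rewrite p_anti ?opprK //; lia.
have GE i : (i < 2)%N -> G *m E i = (E i)^T *m G.
  move=> i2; rewrite /G /E -scalemxAr [(_ *: _)^T]linearZ /= -scalemxAl; congr (_ *: _).
  rewrite trmx_mul mulmxA -(mulmxA _ _ J) pJ; last by lia.
  rewrite (mulmxA _ J) pJ; last by lia.
  by rewrite -!(mulmxA J) -YE // !mulmxA.
pose X (i : nat) : 'M[F]_n := 2^-1 *: (1%:M + E i).
have GX i : (i < 2)%N -> G *m X i = (X i)^T *m G.
  move=> i2; rewrite /X -scalemxAr [(_ *: _)^T]linearZ /= -scalemxAl.
  rewrite [(_ + _)^T]linearD /= trmx1.
  by rewrite mulmxDl mulmxDr GE // mul1mx mulmx1.
have commX : X 0 *m X 1 = X 1 *m X 0.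
  have := @E_comm 1 0 m4 isT; rewrite /X; move: (E 0) (E 1) => U V VU.
  rewrite -!scalemxAr -!scalemxAl !mulmxDl !mulmxDr !mul1mx !mulmx1 VU.
  by rewrite addrACA.
have A2E : A 2 = X 0 *m X 1.
  by rewrite /A !big_ord_recr big_ord0 /= mul1r.
have GA : G *m A 2 = (A 2)^T *m G.
  by rewrite A2E [in RHS]commX mulmxA GX // -mulmxA GX // mulmxA trmx_mul.
have /negbTE evA := idempotent_rank_even AA GT Gu GA.
rewrite (@A_rank 2 m4) -(odd_double_half (\rank (A 2))) evA.
by rewrite add0n -muln2 -mulnA dvdn_mull.
Qed.

End ComplexClifford.

Section CliffordDimension.
Variables (R : realType) (n s m r : nat) (P : 'I_m -> 'M[R]_n).
Hypothesis hP : clifford_system s r P.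
Local Notation cx A := (map_mx (real_complex R) A).

Let p (i : nat) : 'M[R[i]]_n := if insub i is Some j then cx (P j) else 1%:M.
Let e (i : nat) : R[i] :=
  if insub i is Some j then real_complex R (sigJ R m r j j) else 1.

Let p_ord i (h : (i < m)%N) : p i = cx (P (Ordinal h)).
Proof. by rewrite /p insubT. Qed.

Let pp i : p i *m p i = (e i)%:M.
Proof.
rewrite /p /e; case: insubP => [j _ _|_]; last by rewrite mulmx1.
by rewrite -map_mxM /= (clifford_sq hP) map_scalar_mx.
Qed.

Let ee i : e i * e i = 1.
Proof.
rewrite /e; case: insubP => [j _ _|_]; last by rewrite mulr1.
by rewrite -rmorphM /= sigJ_diagM rmorph1.
Qed.

Let p_anti i j : (i < m)%N -> (j < m)%N -> i != j -> p i *m p j = - (p j *m p i).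
Proof.
by move=> hi hj ij; rewrite !p_ord -!map_mxM (clifford_anti hP) /= ?map_mxN.
Qed.

Lemma clifford_dvdn_dim k : (k.*2 <= m)%N -> (2 ^ k %| n)%N.
Proof. exact: (anticommuting_dvdn_dim pp ee p_anti). Qed.

Lemma clifford4_dvdn_dim : (3 < m)%N -> (8 %| n)%N.
Proof.
move=> m4; apply: (anticommuting4_dvdn_dim pp ee p_anti (J := cx (sigJ R n s)) m4).
- by rewrite -map_mxM sigJ_mul map_mx1.
- by rewrite map_trmx trmx_sigJ.
move=> i im; rewrite p_ord map_trmx -!map_mxM; congr (cx _).
by apply/esym/pself_adjointP; apply: (clifford_adj hP).
Qed.

End CliffordDimension.

(** * Equations of the focal variety *)

Section FocalVariety.
Variables (R : realType) (n s m r : nat) (P : 'I_m -> 'M[R]_n).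
Hypothesis hP : clifford_system s r P.
Local Notation pd := (@pdot R n s).
Local Notation eta j := (sigJ R m r j j).
Implicit Types (x v w : 'cV[R]_n).

Lemma derive_clifford_F x v : 'D_v (clifford_F s r P) x =
  4 * pd x x * pd x v
  - 8 * \sum_j eta j * pd (P j *m x) x * pd (P j *m x) v.
Proof.
pose quad (a b c : R) := a%:P + (2 * b) *: 'X + c *: 'X^2.
have quadE a b c h : (quad a b c).[h] = a + 2 * b * h + c * h ^+ 2.
  by rewrite /quad !hornerE.
have dquad a b c : (quad a b c)^`().[0] = 2 * b.
  by rewrite /quad !poly.derivE !hornerE /=; ring.
clearbody quad.
pose p := quad (pd x x) (pd x v) (pd v v) ^+ 2
  - 2 *: \sum_j eta j *: (quad (pd (P j *m x) x) (pd (P j *m x) v)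
                               (pd (P j *m v) v) ^+ 2).
have FE h : clifford_F s r P (h *: v + x) = p.[h].
  rewrite /p hornerD hornerN hornerZ horner_sum horner_exp /clifford_F quadE.
  congr (_ ^+ 2 - 2 * _).
    by rewrite !(pdotDl, pdotDr, pdotZl, pdotZr) (pdotC s v x); ring.
  apply: eq_bigr => j _; rewrite hornerZ horner_exp quadE; congr (_ * _ ^+ 2).
  rewrite mulmxDr -scalemxAr !(pdotDl, pdotDr, pdotZl, pdotZr).
  by rewrite (clifford_adj hP j v x) (pdotC s v); ring.
transitivity ((horner p)^`()%classic 0).
  rewrite derive1E /derive.
  suff -> : (fun h : R => h^-1 *: ((clifford_F s r P \o shift x) (h *: v) - clifford_F s r P x))
          = (fun h : R => h^-1 *: ((horner p \o shift 0) (h *: 1) - p.[0])) by [].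
  apply/funext => h /=; rewrite FE addr0 [h *: 1]mulr1; congr (_ *: (_ - _)).
  by rewrite -FE scale0r add0r.
rewrite -derive.derivE.
rewrite /p derivB hornerD hornerN derivZ hornerZ deriv_exp raddf_sum horner_sum /=.
rewrite hornerMn hornerM dquad expr1 quadE.
under eq_bigr do rewrite derivZ hornerZ deriv_exp hornerMn hornerM dquad expr1 quadE.
congr (_ - _); first by ring.
by rewrite !mulr_sumr; apply: eq_bigr => j _; ring.
Qed.

(** At a critical point [x] the combination of the [P j x] with coefficients
    [eta j * <P j x, x>] is proportional to [x].  The value 1 of [clifford_F]
    makes the factor of proportionality zero, and the [P j x] are independent. *)
Lemma focal_varietyP x : focal_variety s r P x <->
  pd x x = 1 /\ forall j, pd (P j *m x) x = 0.
Proof.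
split=> [[x1 [_ grad0] F1]|[x1 q0]]; last first.
  split=> //; last first.
    rewrite /clifford_F x1 big1 ?mulr0 ?subr0 ?expr1n // => j _.
    by rewrite q0 expr0n mulr0.
  split=> [|v vx]; first exact: pdot0l.
  rewrite derive_clifford_F pdot0l (pdotC s x) vx mulr0 sub0r big1 ?mulr0 ?oppr0 //.
  by move=> j _; rewrite q0 mulr0 mul0r.
split=> //; have {}x1 : pd x x = 1 := x1.
pose u := \sum_j (eta j * pd (P j *m x) x) *: (P j *m x).
have ux : pd u x = 0.
  move: F1; rewrite /clifford_F x1 expr1n pdot_suml => h.
  have -> : \sum_j pd ((eta j * pd (P j *m x) x) *: (P j *m x)) x
          = \sum_j eta j * pd (P j *m x) x ^+ 2.
    by apply: eq_bigr => j _; rewrite pdotZl; ring.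
  lra.
have u0 : u = 0.
  apply: (@pdot_nondegenerate _ _ s) => w; rewrite -(subrK (pd w x *: x) w).
  rewrite pdotDr pdotZr ux mulr0 addr0.
  have vx : pd (w - pd w x *: x) x = 0 by rewrite pdotBl pdotZl x1 mulr1 subrr.
  have := grad0 _ vx; rewrite derive_clifford_F pdot0l (pdotC s x) vx mulr0 sub0r.
  rewrite pdot_suml => h.
  have -> : \sum_j pd ((eta j * pd (P j *m x) x) *: (P j *m x)) (w - pd w x *: x)
      = \sum_j eta j * pd (P j *m x) x * pd (P j *m x) (w - pd w x *: x).
    by apply: eq_bigr => j _; rewrite pdotZl.
  lra.
move=> j; have := orthonormal_coef (focal_gram hP x1) (fun j => eta j * pd (P j *m x) x) j.
by rewrite -/u u0 pdot0l mulrAC sigJ_diagM mul1r.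
Qed.

End FocalVariety.

(** * Curves in the cone over the focal variety *)

Section PolynomialCurve.
Variable R : realFieldType.

Lemma poly_zero_near0 (p : {poly R}) (e : R) : 0 < e ->
  (forall t, 0 < t < e -> p.[t] = 0) -> p = 0.
Proof.
move=> e0 p0; apply/eqP/negPn/negP => pn0.
pose rs := [seq e / (i%:R + 2) | i <- iota 0 (size p)].
have := max_poly_roots (rs := rs) pn0; rewrite size_map size_iota ltnn.
suff [-> ->] : all (root p) rs /\ uniq rs by move=> /(_ isT isT).
split.
  apply/allP => _ /mapP [i _ ->]; apply/rootP/p0.
  have i2 : 1 < i%:R + 2 :> R.
    by have : 0 <= i%:R :> R by []; lra.
  by rewrite divr_gt0 //= ?ltr_pdivrMr ?ltr_pMr //; lra.
rewrite map_inj_uniq ?iota_uniq // => i j /(mulfI (lt0r_neq0 e0)) /invr_inj.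
by move/addIr/eqP; rewrite eqr_nat => /eqP.
Qed.

(** Cramer's rule solves [(1 + t M) nu = k] up to the factor [d = det (1 + t M)],
    keeping the solution polynomial in [t]. *)
Lemma cramer_perturbation (m : nat) (M : 'M[R]_m) (k : 'I_m -> R) :
  exists (d : {poly R}) (nu : 'I_m -> {poly R}), d.[0] = 1 /\
    forall i, nu i + 'X * \sum_j (M i j)%:P * nu j = d * (k i)%:P.
Proof.
pose B : 'M[{poly R}]_m := 1%:M + 'X *: map_mx polyC M.
pose K : 'cV[{poly R}]_m := \col_i (k i)%:P.
exists (\det B), (fun i => (\adj B *m K) i 0); split.
  rewrite -[LHS]/(horner_eval 0 (\det B)) -det_map_mx.
  suff -> : map_mx (horner_eval 0) B = 1%:M by rewrite det1.
  apply/matrixP => i j; rewrite !mxE /horner_eval !hornerE /=.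
  by case: eqP => _; rewrite ?mulr1n ?mulr0n ?hornerE.
move=> i; have E : (B *m (\adj B *m K)) i 0 = \det B * K i 0.
  by rewrite mulmxA mul_mx_adj mul_scalar_mx mxE.
have KE : K i 0 = (k i)%:P by rewrite mxE.
rewrite -KE -E mulmxDl mul1mx -scalemxAl [RHS]mxE; congr (_ + _).
rewrite [RHS]mxE; congr (_ * _); rewrite [RHS]mxE.
by apply: eq_bigr => j _; congr (_ * _); rewrite mxE.
Qed.

End PolynomialCurve.

Section ConeCurve.
Variables (R : realType) (n s m r : nat) (P : 'I_m -> 'M[R]_n).
Hypothesis hP : clifford_system s r P.
Local Notation pd := (@pdot R n s).
Local Notation eta j := (sigJ R m r j j).
Variable x : 'cV[R]_n.
Hypotheses (x1 : pd x x = 1) (q0 : forall j, pd (P j *m x) x = 0).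
Local Notation tangent := (cone_tangent s P x).
Local Notation L := (connected_component (focal_variety s r P) x).
Implicit Types (d : {poly R}) (nu : 'I_m -> {poly R}) (v : 'cV[R]_n).

(** For suitable polynomials [d] and [nu], a curve in the cone over the focal
    variety that leaves [x] in the direction [v]. *)
Definition normal_part nu (t : R) := \sum_j (nu j).[t] *: (P j *m x).

Definition cone_curve d nu v (t : R) :=
  d.[t] *: (x + t *: v) + t ^+ 2 *: normal_part nu t.

Lemma cone_curve_form d nu v t (D : 'M[R]_n) : pself_adjoint s D ->
  pd (D *m cone_curve d nu v t) (cone_curve d nu v t) =
  d.[t] ^+ 2 * (pd (D *m x) x + 2 * t * pd (D *m x) v + t ^+ 2 * pd (D *m v) v)
  + 2 * d.[t] * t ^+ 2 * (pd (D *m x) (normal_part nu t)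
                          + t * pd (D *m v) (normal_part nu t))
  + t ^+ 4 * pd (D *m normal_part nu t) (normal_part nu t).
Proof.
move=> sD; rewrite /cone_curve; set N := normal_part nu t.
rewrite !(mulmxDr, scalerDr) -!scalemxAr !(pdotDl, pdotDr, pdotZl, pdotZr).
rewrite (sD v x) (pdotC s v) (sD N x) (pdotC s N) (sD N v) (pdotC s N (D *m v)).
by ring.
Qed.

Lemma normal_part_form w nu t :
  pd w (normal_part nu t) = (\sum_j (pd w (P j *m x))%:P * nu j).[t].
Proof.
rewrite pdot_sumr horner_sum; apply: eq_bigr => j _.
by rewrite pdotZr !hornerE mulrC.
Qed.

Lemma normal_part_form2 (D : 'M[R]_n) nu t :
  pd (D *m normal_part nu t) (normal_part nu t)
  = (\sum_j \sum_k (pd (D *m (P j *m x)) (P k *m x))%:P * nu k * nu j).[t].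
Proof.
rewrite [in LHS]/normal_part mulmx_sumr pdot_suml horner_sum.
apply: eq_bigr => j _; rewrite -scalemxAr pdotZl -/(normal_part nu t).
by rewrite normal_part_form -mulr_suml hornerM mulrC.
Qed.

(** By [clifford_triple], [<P j u, u>] vanishes on all normal vectors [u], so
    that for given [t] and [v] the equations of the cone are linear in the normal
    correction and are solved, polynomially in [t], by [cramer_perturbation]. *)
Lemma cone_curve_exists v : tangent v -> exists d nu,
  [/\ d.[0] = 1,
      forall j, (nu j).[0] = - (2^-1 * eta j * pd (P j *m v) v)
    & forall t j, pd (P j *m cone_curve d nu v t) (cone_curve d nu v t) = 0].
Proof.
move=> Tv.
pose M : 'M[R]_m := \matrix_(j, k) (eta j * pd (P j *m v) (P k *m x)).
have [d [nu [d0 nuE]]] :=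
  cramer_perturbation M (fun j => - (2^-1 * eta j * pd (P j *m v) v)).
exists d, nu; split=> // [j|t j].
  have /(congr1 (fun p : {poly R} => p.[0])) := nuE j.
  by rewrite hornerD !hornerM hornerX mul0r addr0 hornerC d0 mul1r.
rewrite cone_curve_form; last exact: clifford_adj hP j.
have -> : pd (P j *m normal_part nu t) (normal_part nu t) = 0.
  rewrite normal_part_form2 big1 ?horner0 // => i _; rewrite big1 // => k _.
  by rewrite (clifford_triple hP q0) !mul0r.
have -> : pd (P j *m x) (normal_part nu t) = (nu j).[t] * eta j.
  by rewrite pdotC; apply: (orthonormal_coef (focal_gram hP x1) (fun j => (nu j).[t])).
have := congr1 (fun p : {poly R} => eta j * p.[t]) (nuE j) => /=.
rewrite hornerD !hornerM hornerX hornerC horner_sum mulrDr !mulr_sumr.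
have ME k : M j k = eta j * pd (P j *m v) (P k *m x) by rewrite [LHS]mxE.
under eq_bigr do rewrite hornerM hornerC ME.
have -> : pd (P j *m v) (normal_part nu t)
        = \sum_k (nu k).[t] * pd (P j *m v) (P k *m x).
  by rewrite normal_part_form horner_sum; apply: eq_bigr => k _; rewrite !hornerE mulrC.
have -> : \sum_k eta j * (t * (eta j * pd (P j *m v) (P k *m x) * (nu k).[t]))
        = t * \sum_k (nu k).[t] * pd (P j *m v) (P k *m x).
  rewrite mulr_sumr; apply: eq_bigr => k _.
  by rewrite -[in RHS](mul1r (pd _ (P k *m x))) -(sigJ_diagM R r j); ring.
rewrite q0 (pdotC s (P j *m x) v) Tv; have := sigJ_diagM R r j.
set e := eta j; set S := \sum_k _; set q := pd _ v; move=> ee h.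
have {h}-> : (nu j).[t] * e = - (d.[t] * 2^-1 * q) - t * S.
  apply: (addIr (t * S)); rewrite subrK mulrC h.
  by rewrite -[in RHS](mulr1 q) -ee; ring.
by field.
Qed.

Lemma cone_curve_continuous d nu v : continuous (cone_curve d nu v).
Proof.
move=> t; apply: cvgD.
  apply: cvgZ; first exact: continuous_horner.
  apply: cvgD; first exact: cvg_cst.
  by apply: cvgZr_tmp; exact: cvg_id.
apply: cvgZ; first by apply: exprn_continuous.
rewrite /normal_part; elim: (index_enum _) => [|j w IHw].
  by under eq_fun do rewrite big_nil; rewrite big_nil; apply: cvg_cst.
under eq_fun do rewrite big_cons; rewrite big_cons; apply: cvgD => //.
by apply: cvgZr_tmp; exact: continuous_horner.
Qed.

Lemma cone_curve0 d nu v : d.[0] = 1 -> cone_curve d nu v 0 = x.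
Proof.
by move=> d0; rewrite /cone_curve d0 scale1r scale0r addr0 expr0n /= scale0r addr0.
Qed.

(** Normalising the curve to length 1 on a small interval gives a connected
    subset of the focal variety that contains [x]. *)
Lemma cone_curve_component d nu v : d.[0] = 1 ->
  (forall t j, pd (P j *m cone_curve d nu v t) (cone_curve d nu v t) = 0) ->
  exists2 e : R, 0 < e & forall t, 0 < t < e ->
    exists2 c : R, c != 0 & L (c *: cone_curve d nu v t).
Proof.
set Y := cone_curve d nu v => d0 Yq; pose N t := pd (Y t) (Y t).
have Nc : continuous N.
  pose p : {poly R} := d ^+ 2 * ((pd x x)%:P + (2 * pd x v)%:P * 'X
      + (pd v v)%:P * 'X ^+ 2)
    + 2%:P * d * 'X ^+ 2 * (\sum_j (pd x (P j *m x))%:P * nu j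
        + 'X * \sum_j (pd v (P j *m x))%:P * nu j)
    + 'X ^+ 4 * \sum_j \sum_k
        (pd (1%:M *m (P j *m x)) (P k *m x))%:P * nu k * nu j.
  suff -> : N = horner p by exact: continuous_horner.
  apply/funext => t; rewrite /N -{1}[Y t]mul1mx cone_curve_form; last first.
    by move=> u w; rewrite !mul1mx.
  rewrite normal_part_form2 !mul1mx !normal_part_form /p.
  rewrite !(hornerD, hornerM, hornerC, hornerX, horner_exp).
  by ring.
have N0 : 0 < N 0 by rewrite /N /Y cone_curve0 // x1.
have [e e0 eN] : exists2 e : R, 0 < e & forall t, `|t| < e -> 0 < N t.
  have := Nc 0 _ (lt_nbhsr N0).
  case/nbhs_ballP => e /= e0 be; exists e => // t te; apply: be.
  by rewrite /ball /= sub0r normrN.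
pose g (t : R) := (Num.sqrt (N t))^-1 *: Y t.
exists e => // t /andP [t0 te]; exists (Num.sqrt (N t))^-1.
  by rewrite invr_eq0 gt_eqF // sqrtr_gt0; apply: eN; rewrite gtr0_norm.
have small z : `[0, t]%classic z -> `|z| < e.
  by rewrite /= in_itv /= => /andP [z0 zt]; rewrite ger0_norm // (le_lt_trans zt).
suff : (g @` `[0, t]) `<=` L.
  by apply; exists t => //=; rewrite in_itv /= lexx (ltW t0).
apply: connected_component_max.
- exists 0; first by rewrite /= in_itv /= lexx (ltW t0).
  by rewrite /g /N /Y cone_curve0 // x1 sqrtr1 invr1 scale1r.
- move=> _ [z /small /eN Nz <-]; apply/focal_varietyP => //; split=> [|j].
    rewrite /g pdotZl pdotZr mulrA -invfM -expr2 sqr_sqrtr ?(ltW Nz) //.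
    by rewrite mulVf // gt_eqF.
  by rewrite /g -scalemxAr pdotZl pdotZr Yq !mulr0.
- apply: connected_continuous_connected; first exact: segment_connected.
  apply: continuous_in_subspaceT => z /set_mem /small /eN Nz.
  apply: cvgZ; last exact: cone_curve_continuous.
  apply: cvgV; first by rewrite gt_eqF // sqrtr_gt0.
  by apply: continuous_comp; [exact: Nc|exact: sqrt_continuous].
Qed.

(** The polynomial [<D Y(t), Y(t)>] vanishes near 0 along the curves [Y] of
    [cone_curve_exists]; these are its coefficients of orders one, two and
    three. *)
Lemma component_jets (D : 'M[R]_n) v : pself_adjoint s D ->
  (forall z, L z -> pd (D *m z) z = 0) -> tangent v ->
  pd (D *m x) v = 0 /\ (D *m x = 0 ->
    pd (D *m v) v = 0 /\
    \sum_j eta j * pd (P j *m v) v * pd (D *m v) (P j *m x) = 0).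
Proof.
move=> sD DL Tv; have [d [nu [d0 nu0 Yq]]] := cone_curve_exists Tv.
have [e e0 eL] := cone_curve_component d0 Yq.
pose A : {poly R} := \sum_j (pd (D *m x) (P j *m x))%:P * nu j.
pose B : {poly R} := \sum_j (pd (D *m v) (P j *m x))%:P * nu j.
pose C : {poly R} := \sum_j \sum_k
  (pd (D *m (P j *m x)) (P k *m x))%:P * nu k * nu j.
have Dx : pd (D *m x) x = 0.
  by apply/DL/connected_component_refl/focal_varietyP.
have DY t : 0 < t < e -> d.[t] ^+ 2 * (2 * t * pd (D *m x) v + t ^+ 2 * pd (D *m v) v)
  + 2 * d.[t] * t ^+ 2 * (A.[t] + t * B.[t]) + t ^+ 4 * C.[t] = 0.
  move=> /eL [c c0 /DL]; rewrite -scalemxAr pdotZl pdotZr mulrA => /eqP.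
  rewrite mulf_eq0 mulf_eq0 (negPf c0) /= cone_curve_form // Dx => /eqP <-.
  by rewrite normal_part_form2 !normal_part_form add0r.
have divX (p : {poly R}) : (forall t, 0 < t < e -> t * p.[t] = 0) -> p.[0] = 0.
  move=> p0; rewrite (_ : p = 0) ?horner0 //; apply: (poly_zero_near0 e0) => t te.
  have /eqP := p0 _ te; rewrite mulf_eq0 => /orP [/eqP t0|/eqP //].
  by move: te; rewrite t0 ltxx.
have Dxv : pd (D *m x) v = 0.
  pose p : {poly R} := d ^+ 2 * ((2 * pd (D *m x) v)%:P + (pd (D *m v) v)%:P * 'X)
    + 2%:P * d * 'X * (A + 'X * B) + 'X ^+ 3 * C.
  have : p.[0] = 0.
    apply: divX => t /DY <-; rewrite /p.
    by rewrite !(hornerD, hornerM, hornerC, hornerX, horner_exp); ring.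
  rewrite /p !(hornerD, hornerM, hornerC, hornerX, horner_exp) d0 => h.
  lra.
split=> // Dx0; have A0 t : A.[t] = 0.
  rewrite /A horner_sum big1 // => j _.
  by rewrite Dx0 pdot0l hornerM hornerC mul0r.
have Dvv : pd (D *m v) v = 0.
  pose p : {poly R} := d ^+ 2 * (pd (D *m v) v)%:P + 2%:P * d * 'X * B + 'X ^+ 2 * C.
  have : p.[0] = 0.
    apply: divX => t te; have /andP [t0 _] := te; apply: (mulfI (lt0r_neq0 t0)).
    rewrite mulr0 -[RHS](DY _ te) A0 Dxv /p.
    by rewrite !(hornerD, hornerM, hornerC, hornerX, horner_exp); ring.
  rewrite /p !(hornerD, hornerM, hornerC, hornerX, horner_exp) d0 => h.
  lra.
split=> //.
have B0 : B.[0] = 0.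
  pose p : {poly R} := 2%:P * d * B + 'X * C.
  have : p.[0] = 0.
    apply: divX => t te; have /andP [t0 _] := te.
    apply: (mulfI (lt0r_neq0 t0)); apply: (mulfI (lt0r_neq0 t0)).
    rewrite !mulr0 -[RHS](DY _ te) A0 Dxv Dvv /p.
    by rewrite !(hornerD, hornerM, hornerC, hornerX, horner_exp); ring.
  rewrite /p !(hornerD, hornerM, hornerC, hornerX, horner_exp) d0 => h.
  lra.
have : -2 * B.[0] = 0 by rewrite B0 mulr0.
rewrite /B horner_sum mulr_sumr => h; rewrite -[RHS]h; apply: eq_bigr => j _.
by rewrite hornerM hornerC nu0; field.
Qed.

End ConeCurve.

(** * The volume element *)

Section VolumeElement.
Variables (R : realType) (n s m r : nat) (P : 'I_m -> 'M[R]_n).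
Hypothesis hP : clifford_system s r P.
Local Notation pd := (@pdot R n s).
Local Notation eta j := (sigJ R m r j j).

Definition volume : 'M[R]_n := \prod_j P j.

Let anti i j : i != j -> P i * P j = - (P j * P i).
Proof. exact: (clifford_anti hP). Qed.

Let word_adj w u v :
  pd (\prod_(i <- w) P i *m u) v = pd u (\prod_(i <- rev w) P i *m v).
Proof.
elim: w u v => [|k w IHw] u v; first by rewrite !big_nil !mul1mx.
rewrite rev_cons -cats1 big_cat big_cons big_seq1 /= -!mulmxE -!mulmxA.
by rewrite (clifford_adj hP) IHw.
Qed.

Let size_enum : size (index_enum 'I_m) = m.
Proof.
rewrite -(card_uniqP (index_enum_uniq _)) -[RHS]card_ord.
by apply: eq_card => i; rewrite mem_index_enum.
Qed.

Let rev_enum : (4 %| m)%N ->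
  \prod_(i <- rev (index_enum 'I_m)) P i = volume.
Proof.
move=> m4; rewrite (word_rev anti (index_enum_uniq _)) size_enum mulr_sign.
suff -> : odd 'C(m, 2) = false by [].
case/dvdnP: m4 => q ->; rewrite bin2; set k := (_ * 4).-1.
have -> : (q * 4 * k)%N = (q * k).*2.*2 by rewrite -!muln2; ring.
by rewrite doubleK odd_double.
Qed.

Lemma volume_adj : (4 %| m)%N -> pself_adjoint s volume.
Proof. by move=> m4 u v; rewrite word_adj rev_enum. Qed.

Lemma volume_anti k : (4 %| m)%N -> P k *m volume = - (volume *m P k).
Proof.
move=> m4; have ev : ~~ odd (size (index_enum 'I_m)) by rewrite size_enum; lia.
exact: (word_anti anti (index_enum_uniq _) (mem_index_enum k) ev).
Qed.

Lemma volume_sq : (4 %| m)%N -> ~~ odd r -> (r <= m)%N ->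
  volume *m volume = 1%:M.
Proof.
move=> m4 r2 rm; rewrite -[X in _ *m X](rev_enum m4).
have cC i (a : 'M[R]_n) : (eta i)%:M * a = a * (eta i)%:M.
  by rewrite -mulmxE scalar_mxC.
transitivity (\prod_i (eta i)%:M : 'M[R]_n).
  exact: (word_mul_rev (index_enum _) (clifford_sq hP) cC).
have -> : \prod_i (eta i)%:M = (\prod_i eta i)%:M :> 'M[R]_n.
  by elim/big_rec2: _ => [|i a b _ ->] //; rewrite scalar_mxM.
congr (_%:M).
under eq_bigr do rewrite sigJE eqxx mulr1n.
rewrite -big_mkcond /= -(big_ord_widen m (fun=> -1) rm) prodr_const card_ord.
by rewrite -signr_odd (negPf r2).
Qed.

End VolumeElement.

Section Component.
Variables (R : realType) (n s m r : nat) (P : 'I_m -> 'M[R]_n).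
Hypothesis hP : clifford_system s r P.
Local Notation pd := (@pdot R n s).
Local Notation eta j := (sigJ R m r j j).
Local Notation M := (focal_variety s r P).
Hypotheses (m0 : (0 < m)%N) (m4 : (4 %| m)%N) (r2 : ~~ odd r) (rm : (r <= m)%N).
Variable x : 'cV[R]_n.
Hypothesis Mx : M x.
Local Notation L := (connected_component M x).
Local Notation V := (volume P).

Let x1 : pd x x = 1. Proof. by case/(focal_varietyP hP): Mx. Qed.
Let q0 j : pd (P j *m x) x = 0. Proof. by case/(focal_varietyP hP): Mx. Qed.

(** Suppose that the form is constantly [h].  Then [D = V - h] has zero form on the
    component, so by [component_jets] it maps the tangent space of the cone to the
    normal space.  As [V] anticommutes with the [P j], [D x = 0] and the normal
    space is an eigenspace of [V] for [- h]; hence [D] vanishes on the tangent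
    space and has rank at most [m].  Conjugation by some [P k] exchanges [V - h]
    and [- (V + h)], so [V + h] too has rank at most [m], and the difference
    [2 h] of the two is invertible. *)
Lemma volume_form_not_constant (h : R) :
  (forall z, L z -> pd (V *m z) z = h) -> (n <= 2 * m)%N.
Proof.
move=> hL; pose D := V - h%:M.
have sV := volume_adj hP m4; have VP := volume_anti hP _ m4.
have sD : pself_adjoint s D.
  by move=> u v; rewrite !mulmxBl !mul_scalar_mx pdotBl pdotBr sV pdotZl pdotZr.
have DL z : L z -> pd (D *m z) z = 0.
  move=> Lz; have /(focal_varietyP hP) [z1 _] := connected_component_sub Lz.
  by rewrite mulmxBl mul_scalar_mx pdotBl pdotZl z1 mulr1 hL // subrr.
have jets v : cone_tangent s P x v -> _ := component_jets hP x1 q0 sD DL.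
have VxP j : pd (V *m x) (P j *m x) = 0.
  have : pd (V *m x) (P j *m x) = - pd (V *m x) (P j *m x).
    rewrite {1}pdotC (clifford_adj hP) mulmxA VP mulNmx pdotNr -mulmxA.
    by rewrite -sV.
  by move=> h2; lra.
have Dx : D *m x = 0.
  rewrite [LHS](cone_normal_expand hP x1); last by move=> v /jets [].
  rewrite big1 // => j _; rewrite mulmxBl mul_scalar_mx pdotBl pdotZl VxP.
  by rewrite (pdotC s x) q0 mulr0 subr0 mulr0 scale0r.
have Vx : V *m x = h *: x.
  by apply/eqP; rewrite -subr_eq0 -mul_scalar_mx -mulmxBl Dx.
have DPx j : D *m (P j *m x) = - (2 * h) *: (P j *m x).
  rewrite mulmxBl mul_scalar_mx mulmxA -[V *m P j]opprK -VP mulNmx -mulmxA Vx.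
  by rewrite -scalemxAr -opprD -scalerDl scaleNr -mulr2n mulr_natl.
have DT v : cone_tangent s P x v -> D *m v = 0.
  move=> Tv; rewrite [LHS](cone_normal_expand hP x1).
    rewrite big1 // => j _; rewrite sD DPx pdotZr Tv !mulr0.
    by rewrite scale0r.
  move=> w Tw; apply: (pdot_polar (W := cone_tangent s P x) sD) => //.
    by move=> *; apply: cone_tangentD.
  by move=> u /jets [_ /(_ Dx) []].
(* [N *m K] is the projection onto the normal space *)
pose N := \matrix_(i < n, j < m) (P j *m x) i 0.
pose K := \matrix_(j < m, i < n) (eta j * pd (delta_mx i 0) (P j *m x)).
have rD : (\rank D <= m)%N.
  suff -> : D = (D *m N) *m K.
    exact: leq_trans (mxrankM_maxr _ _) (rank_leq_row _).
  apply: eq_mulmx_col => v; rewrite -!mulmxA.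
  have -> : N *m (K *m v) = \sum_j (eta j * pd v (P j *m x)) *: (P j *m x).
    have NE i j : N i j = (P j *m x) i 0 by rewrite [LHS]mxE.
    have KE j i : K j i = eta j * pd (delta_mx i 0) (P j *m x) by rewrite [LHS]mxE.
    apply/colP => i; rewrite mxE summxE; apply: eq_bigr => j _.
    rewrite NE [RHS]mxE mulrC; congr (_ * _); rewrite mxE.
    rewrite [in RHS](matrix_sum_delta v) pdot_suml mulr_sumr; apply: eq_bigr => k _.
    by rewrite big_ord1 pdotZl KE; ring.
  set p := \sum_j _; apply/eqP; rewrite -subr_eq0 -mulmxBr DT //.
  move=> j; exact: (orthonormal_proj (focal_gram hP x1) (@sigJ_diagM _ _ _)).
have rD' : (\rank (V + h%:M)%R <= m)%N.
  pose k := Ordinal m0.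
  have -> : (V + h%:M)%R = (- eta k) *: (P k *m D *m P k).
    have -> : P k *m D *m P k = - eta k *: (V + h%:M).
      rewrite mulmxBr mulmxBl VP mulNmx -(mulmxA V) mul_mx_scalar -scalemxAl.
      rewrite (clifford_sq hP) mul_mx_scalar scaleNr scalerDr !scale_scalar_mx.
      by rewrite opprD [h * _]mulrC.
    by rewrite scalerA mulrNN sigJ_diagM scale1r.
  apply: leq_trans (mxrank_scale _ _) _.
  by apply: leq_trans (mxrankM_maxl _ _) _; apply: leq_trans (mxrankM_maxr _ _) rD.
have h0 : h != 0.
  apply/eqP => h0; have := volume_sq hP m4 r2 rm.
  move=> /(congr1 (fun A : 'M[R]_n => pd (A *m x) x)).
  rewrite -mulmxA Vx h0 scale0r mulmx0 pdot0l mul1mx x1 => /eqP.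
  by rewrite eq_sym oner_eq0.
have : (\rank ((V + h%:M) - D)%R <= m + m)%N.
  by apply: leq_trans (mxrank_add _ _) _; rewrite leq_add // mxrank_opp.
have -> : ((V + h%:M) - D)%R = (2 * h) *: 1%:M.
  rewrite opprB [h%:M - _]addrC addrACA subrr add0r -mulr2n -raddfMn /=.
  by rewrite scale_scalar_mx mulr1 mulr_natl.
by rewrite mxrank_scale_nz ?mxrank1 ?mulf_neq0 ?pnatr_eq0 //; lia.
Qed.

End Component.

(** * Isometries preserving a component *)

Section Rotation.
Variables (R : realType) (n s m r : nat) (P : 'I_m -> 'M[R]_n).
Hypothesis hP : clifford_system s r P.
Local Notation H := (sigJ R m r).

Lemma clifford_rotate (K : 'M[R]_m) : K *m H *m K^T = H ->
  clifford_system s r (fun i => clifford_comb P (K i)).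
Proof.
move=> KHK; split=> [i|i j]; first exact: (clifford_comb_adj hP).
rewrite {2 3}/clifford_comb mulmx_sumr mulmx_suml -big_split /=.
under eq_bigr do rewrite -scalemxAr -scalemxAl -scalerDr (clifford_comb_anti hP)
  scale_scalar_mx.
rewrite -raddf_sum /=; congr (_%:M); rewrite -[in RHS]KHK.
rewrite [in RHS]mxE mulr_sumr; apply: eq_bigr => k _.
rewrite mul_mx_diag; rewrite mxE [H _ _]mxE eqxx mulr1n.
by rewrite [K^T _ _]mxE; ring.
Qed.

End Rotation.

Section Isometry.
Variables (R : realType) (n s : nat).
Local Notation pd := (@pdot R n s).

Lemma isometry_dot (A : 'M[R]_n) u v : pseudo_orthogonal s A ->
  pd (A *m u) (A *m v) = pd u v.
Proof.
move=> AO; rewrite /pdot trmx_mul -!mulmxA; congr ((_ *m _) 0 0).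
by rewrite !mulmxA AO.
Qed.

Lemma isometry_unit (A : 'M[R]_n) : pseudo_orthogonal s A -> A \in unitmx.
Proof.
move=> AO; have : sigJ R n s *m A^T *m sigJ R n s *m A = 1%:M.
  transitivity (sigJ R n s *m (A^T *m sigJ R n s *m A)); first by rewrite !mulmxA.
  by rewrite AO sigJ_mul.
by case/mulmx1_unit.
Qed.

End Isometry.

Section Stabiliser.
Variables (R : realType) (n s m r : nat) (P : 'I_m -> 'M[R]_n).
Hypothesis hP : clifford_system s r P.
Local Notation pd := (@pdot R n s).
Local Notation eta j := (sigJ R m r j j).
Local Notation H := (sigJ R m r).
Local Notation M := (focal_variety s r P).

(** The conjugates [Q j] of the [P j] by [A] form a Clifford system whose forms
    vanish on the component.  By [component_jets] at first order each [Q j x] is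
    a combination, with matrix [Lam], of the [P k x], and [Lam] is orthogonal for
    the signature form.  Undoing this rotation gives a system that agrees with
    [P] at [x], hence everywhere by [clifford_rigid].  So the [Q j] are the
    combinations of the [P k] with matrix [Lam], and the conjugate of the volume
    element is [\det Lam] times the volume element; both square to 1. *)
Lemma isometry_volume (A : 'M[R]_n) x : (4 %| m)%N -> ~~ odd r -> (r <= m)%N ->
  (4 * m <= n)%N -> pseudo_orthogonal s A -> M x ->
  (forall z, connected_component M x z -> M (A *m z)) ->
  pd (volume P *m (A *m x)) (A *m x) ^+ 2 = pd (volume P *m x) x ^+ 2.
Proof.
move=> m4 r2 rm mn AO Mx AM.
have [x1 q0] := (focal_varietyP hP x).1 Mx.
have Au := isometry_unit AO; pose B := invmx A.
have BA : B *m A = 1%:M by exact: mulVmx.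
have AB : A *m B = 1%:M by exact: mulmxV.
have Bdot u v : pd (B *m u) v = pd u (A *m v).
  by rewrite -(isometry_dot (B *m u) v AO) mulmxA AB mul1mx.
pose Q j := B *m P j *m A.
have QA j (v : 'cV[R]_n) : Q j *m v = B *m (P j *m (A *m v)) by rewrite /Q -!mulmxA.
have QQ i j : Q i *m Q j = B *m (P i *m P j) *m A.
  by rewrite /Q -!mulmxA; do 2 congr (_ *m _); rewrite !mulmxA AB mul1mx.
have hQ : clifford_system s r Q.
  split=> [j u v|i j].
    by rewrite !QA Bdot (clifford_adj hP) [in RHS]pdotC Bdot pdotC.
  rewrite !QQ -mulmxDl -mulmxDr (clifford_rel hP).
  by rewrite mul_mx_scalar -scalemxAl BA scalemx1.
have QL j z : connected_component M x z -> pd (Q j *m z) z = 0.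
  move=> /AM /(focal_varietyP hP) [_ q0A].
  by rewrite QA Bdot.
have Qx j : Q j *m x = \sum_k (eta k * pd (Q j *m x) (P k *m x)) *: (P k *m x).
  apply: (cone_normal_expand hP x1) => v Tv.
  by have [] := component_jets hP x1 q0 (clifford_adj hQ j) (QL j) Tv.
pose Lam : 'M[R]_m := \matrix_(j, k) (eta k * pd (Q j *m x) (P k *m x)).
have {}Qx j : Q j *m x = \sum_k Lam j k *: (P k *m x).
  by rewrite [LHS]Qx; apply: eq_bigr => k _; rewrite [Lam _ _]mxE.
have LHL : Lam *m H *m Lam^T = H.
  apply/matrixP => i j; have := clifford_gram hQ x i j.
  rewrite x1 mulr1 => <-; rewrite (Qx j) pdot_sumr mxE; apply: eq_bigr => k _.
  rewrite pdotZr Qx (orthonormal_coef (focal_gram hP x1)).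
  rewrite mul_mx_diag [X in X * _]mxE [H k k]mxE eqxx mulr1n [Lam^T _ _]mxE.
  by rewrite mulrC [X in _ * (_ * X)]mxE.
have HH : H *m H = 1%:M by exact: sigJ_mul.
pose K := H *m Lam^T *m H.
have LK : Lam *m K = 1%:M by rewrite /K !mulmxA LHL HH.
have KL : K *m Lam = 1%:M by exact: mulmx1C.
have KLE i k : \sum_j K i j * Lam j k = (i == k)%:R.
  by transitivity ((K *m Lam) i k); [rewrite [RHS]mxE|rewrite KL mxE].
have LKE i k : \sum_j Lam i j * K j k = (i == k)%:R.
  by transitivity ((Lam *m K) i k); [rewrite [RHS]mxE|rewrite LK mxE].
have KT : K^T = H *m Lam *m H by rewrite /K !trmx_mul trmxK trmx_sigJ mulmxA.
have KHK : K *m H *m K^T = H.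
  rewrite KT -[RHS]mul1mx -KL !mulmxA; congr (_ *m _).
  by rewrite -(mulmxA K) HH mulmx1.
pose Q' i := clifford_comb Q (K i).
have hQ' : clifford_system s r Q'.
  exact: (clifford_rotate hQ KHK).
have Q'E i (v : 'cV[R]_n) : Q' i *m v = \sum_j K i j *: (Q j *m v).
  exact: clifford_combE.
have Q'x i : Q' i *m x = P i *m x.
  rewrite Q'E; under eq_bigr do rewrite Qx scaler_sumr.
  rewrite exchange_big /= -[RHS](scale1r _) (bigD1 i) //=.
  rewrite [X in _ + X]big1 ?addr0 => [|k ki].
    under eq_bigr do rewrite scalerA.
    by rewrite -scaler_suml KLE eqxx.
  under eq_bigr do rewrite scalerA.
  by rewrite -scaler_suml KLE eq_sym (negPf ki) scale0r.
have Q'P i : Q' i = P i.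
  have sD : pself_adjoint s (Q' i - P i).
    by apply: pself_adjointB; [apply: (clifford_adj hQ')|apply: (clifford_adj hP)].
  have DL z : connected_component M x z -> pd ((Q' i - P i) *m z) z = 0.
    move=> Lz; have /(focal_varietyP hP) [_ q0z] := connected_component_sub Lz.
    rewrite mulmxBl pdotBl q0z subr0 Q'E pdot_suml big1 // => j _.
    by rewrite pdotZl QL // mulr0.
  have Dx : (Q' i - P i) *m x = 0 by rewrite mulmxBl Q'x subrr.
  have jets v : cone_tangent s P x v -> _ := component_jets hP x1 q0 sD DL.
  apply: (clifford_rigid hP hQ' x1 q0 Q'x) => // v Tv.
    by have [_ /(_ Dx) []] := jets v Tv.
  by have [_ /(_ Dx) []] := jets v Tv.
have QE j : Q j = \sum_k Lam j k *: P k.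
  apply: eq_mulmx_col => v.
  transitivity (\sum_k Lam j k *: (Q' k *m v)); last first.
    by rewrite mulmx_suml; apply: eq_bigr => k _; rewrite Q'P -scalemxAl.
  under eq_bigr do rewrite Q'E scaler_sumr.
  rewrite exchange_big /= -[LHS]scale1r (bigD1 j) //=.
  rewrite [X in _ + X]big1 ?addr0 => [|k kj].
    under eq_bigr do rewrite scalerA.
    by rewrite -scaler_suml LKE eqxx.
  under eq_bigr do rewrite scalerA.
  by rewrite -scaler_suml LKE eq_sym (negPf kj) scale0r.
have volQ : B *m volume P *m A = \det Lam *: volume P.
  rewrite -(prod_anticommuting_det (clifford_anti hP) (clifford_anti hQ) QE).
  rewrite /volume; elim/big_rec2: _ => [|i X Y _ <-]; first by rewrite mulmx1.
  by rewrite -mulmxE /Q -!mulmxA; do 2 congr (_ *m _); rewrite !mulmxA AB mul1mx.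
set V := volume P in volQ *; set dl := \det Lam in volQ.
have VE : pd (V *m (A *m x)) (A *m x) = dl * pd (V *m x) x.
  by rewrite -Bdot !mulmxA volQ -scalemxAl pdotZl.
suff dl2 : dl ^+ 2 = 1 by rewrite VE exprMn dl2 mul1r.
have VV := volume_sq hP m4 r2 rm.
have : (B *m V *m A) *m (B *m V *m A) = 1%:M.
  transitivity (B *m (V *m (A *m B) *m V) *m A); first by rewrite !mulmxA.
  by rewrite AB mulmx1 VV mulmx1.
rewrite volQ -scalemxAl -scalemxAr scalerA VV -expr2.
move=> /(congr1 (fun X : 'M[R]_n => pd (X *m x) x)).
by rewrite -scalemxAl pdotZl mul1mx x1 mulr1.
Qed.

End Stabiliser.

(** The positive number [n] is a multiple of [2 ^ (m / 2)], which is at least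
    [4 m] when [12 <= m].  For [m = 8] and [m = 4] it is a multiple of 16 and of 8
    respectively, and exceeds [2 m]. *)
Lemma clifford_dim_bound (R : realType) (n s m r : nat) (P : 'I_m -> 'M[R]_n) :
  clifford_system s r P -> (0 < m)%N -> (4 %| m)%N ->
  (2 * m < n)%N -> (4 * m <= n)%N.
Proof.
move=> hP m0 /dvdnP [q mE] mn.
have q0 : (0 < q)%N by lia.
have [q1|q1] := leqP q 1.
  have m4 : m = 4 by lia.
  have := clifford4_dvdn_dim hP; rewrite m4 => /(_ isT) /dvdnP [k nE].
  by lia.
have : (2 ^ (2 * q) %| n)%N by apply: (clifford_dvdn_dim hP); lia.
case/dvdnP=> k nE; have k0 : (0 < k)%N by case: k nE => //; lia.
have [q2|q2] := leqP q 2.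
  have q2' : q = 2 by lia.
  by move: nE; rewrite q2' /=; lia.
suff q4 : (16 * q <= 2 ^ (2 * q))%N.
  by have := leq_pmull (2 ^ (2 * q)) k0; rewrite -nE; lia.
have [p ->] : exists p, q = p.+3 by exists (q - 3)%N; lia.
elim: p => // p IHp; have -> : (2 * p.+4)%N = (2 * p.+3).+2 by lia.
by move: (2 * p.+3)%N IHp => i IHp; rewrite !expnS; lia.
Qed.

(** * Inhomogeneity *)

Lemma continuous_form (R : realType) (n s : nat) (Q : 'M[R]_n) :
  continuous (fun z : 'cV[R]_n => pdot s (Q *m z) z).
Proof.
have cont_sum (I : Type) (w : seq I) (F : I -> 'cV[R]_n -> R) :
    (forall i, continuous (F i)) -> continuous (fun z => \sum_(i <- w) F i z).
  move=> Fc z; elim: w => [|i w IHw].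
    by under eq_fun do rewrite big_nil; exact: cst_continuous.
  by under eq_fun do rewrite big_cons; apply: continuousD; [exact: Fc|exact: IHw].
have -> : (fun z : 'cV[R]_n => pdot s (Q *m z) z)
    = (fun z => \sum_j \sum_i z i 0 * (Q^T *m sigJ R n s) i j * z j 0).
  apply/funext => z; rewrite /pdot trmx_mul -(mulmxA z^T) mxE.
  apply: eq_bigr => j _; rewrite mxE mulr_suml; apply: eq_bigr => i _.
  by rewrite [z^T _ _]mxE.
have ent i : continuous (fun z : 'cV[R]_n => z i 0) by exact: coord_continuous.
apply: (cont_sum _ _ _) => j; apply: (cont_sum _ _ _) => i z.
have h1 : {for z, continuous ((fun z : 'cV[R]_n => z i 0)
                              \* cst ((Q^T *m sigJ R n s) i j))}.
  by apply: continuousM; [exact: ent|exact: cst_continuous].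
exact: (continuousM h1 (ent j z)).
Qed.

(** If [f] took two opposite non-zero values on [L], it would also vanish
    there. *)
Lemma connected_sqr_constant (T : topologicalType) (R : realType) (L : set T)
    (f : T -> R) (a : R) : connected L -> continuous f ->
  (forall z, L z -> f z ^+ 2 = a ^+ 2) ->
  forall y z, L y -> L z -> f y = f z.
Proof.
move=> cL cf f2 y z Ly Lz.
have : connected (f @` L).
  by apply: connected_continuous_connected => //; apply: continuous_subspaceT.
move=> /connected_intervalP If.
have [//|yz] := eqVneq (f y) (f z).
have fyz : f y = - f z.
  have /eqP : f y ^+ 2 = f z ^+ 2 by rewrite !f2.
  by rewrite eqf_sqr (negPf yz) /= => /eqP.
have [w Lw fw] : (f @` L) 0.
  have [fz0|fz0] := leP 0 (f z).
    by apply: (If (f y) (f z)); [exists y|exists z|rewrite fyz oppr_le0 fz0].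
  by apply: (If (f z) (f y)); [exists z|exists y|rewrite fyz oppr_ge0 (ltW fz0)].
have : f z ^+ 2 = 0 by rewrite f2 // -(f2 w Lw) fw expr0n.
by move=> /eqP; rewrite expf_eq0 /= fyz => /eqP ->; rewrite oppr0.
Qed.

Theorem theorem4p18 (R : realType) (l s m r : nat)
    (P : 'I_m -> 'M[R]_(2 * l))
    (hl : (0 < l)%N) (hm : (1 < m)%N) (hr : (r <= m)%N)
    (hs : (s <= 2 * l - 1)%N)
    (hP : clifford_system s r P)
    (hm4 : m = 0 %[mod 4]) (hr2 : r = 0 %[mod 2]) (hlm : (m < l)%N)
    (x : 'cV[R]_(2 * l)) (hx : focal_variety s r P x) :
  ~ homogeneous s (connected_component (focal_variety s r P) x).
Proof.
set L := connected_component _ x.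
move=> [H [[[HO _ _ _] _] HL Htrans]].
have m0 : (0 < m)%N by lia.
have m4 : (4 %| m)%N by apply/eqP; rewrite hm4.
have r2 : ~~ odd r by move: hr2; rewrite !modn2; case: odd.
have mn : (4 * m <= 2 * l)%N by apply: (clifford_dim_bound hP) => //; lia.
have Lx : L x by exact: connected_component_refl.
pose f z := pdot s (volume P *m z) z.
have f2 z : L z -> f z ^+ 2 = f x ^+ 2.
  move=> Lz; have [A HA <-] := Htrans x z Lx Lz.
  apply: (isometry_volume hP) => //; first exact: HO.
  by move=> y Ly; apply: (@connected_component_sub _ _ x); apply: HL.
have fc z : L z -> f z = f x.
  move=> Lz; apply: (connected_sqr_constant _ _ f2) => //.
    exact: component_connected.
  exact: continuous_form.
by have := volume_form_not_constant hP m0 m4 r2 hr hx fc; lia.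
Qed.
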